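(* Let $(\Omega,F,\mathscr L^n)$ be an $n$-dimensional forward complete projectively flat Finsler manifold endowed with the Lebesgue measure $\mathscr L^n$, where $\Omega\subset\mathbb R^n$ is a domain. Assume that $\mathbf S\geq (n-1)h$ for some constant $h>0$. Then the following statements hold: (i) $\Omega$ is a bounded domain in $\mathbb R^n$; (ii) $(\Omega,F)$ is not backward complete; (iii) $\lambda_F(\Omega)=+\infty$.
   Context: $n\ge2$; a domain is a nonempty connected open subset of $\mathbb R^n$. A Minkowski norm on a vector space $V$ is a function $\phi:V\to[0,\infty)$, $C^\infty$ on $V\setminus\{0\}$, with $\phi(y)=0$ iff $y=0$, $\phi(\alpha y)=\alpha\phi(y)$ for $\alpha>0$, and with $\frac12\frac{\partial^2\phi^2}{\partial y^i\partial y^j}(y)$ positive definite for $y\neq0$. A Finsler metric $F=F(x,y)$ on $\Omega$ is a function on $T\Omega=\Omega\times\mathbb R^n$, $C^\infty$ on $T\Omega\setminus\{0\}$, whose restriction to each $T_x\Omega=\mathbb R^n$ is a Minkowski norm. Put $g_{ij}(x,y)=\frac12\frac{\partial^2F^2}{\partial y^i\partial y^j}(x,y)$, with inverse $(g^{ij})$. Reversibility: $\lambda_F(\Omega)=\sup_{x\in\Omega}\sup_{y\in T_x\Omega\setminus\{0\}}\frac{F(x,-y)}{F(x,y)}$. Geodesics are the solutions of $\ddot\gamma^i+2G^i(\gamma,\dot\gamma)=0$, where $G^i=\frac14g^{ij}\{\frac{\partial^2F^2}{\partial x^l\partial y^j}y^l-\frac{\partial F^2}{\partial x^j}\}$; $\gamma_y$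 is the geodesic with initial velocity $y$. $(\Omega,F)$ is forward complete if every geodesic on $[0,1)$ extends to a geodesic on $[0,+\infty)$, and backward complete if every geodesic on $(0,1]$ extends to a geodesic on $(-\infty,1]$. $F$ is projectively flat if the images of all geodesics are (contained in) straight lines of $\mathbb R^n$. $S$-curvature with respect to $\mathscr L^n$: with $\tau(x,y)=\ln\sqrt{\det g_{ij}(x,y)}$ in the standard coordinates of $\mathbb R^n$, $\mathbf S(x,y)=\frac{\mathrm d}{\mathrm dt}\big|_{t=0}\tau(\gamma_y(t),\gamma_y'(t))$. $\mathbf S\ge a$ means $\mathbf S(x,y)\ge aF(x,y)$ for all $(x,y)\in T\Omega\setminus\{0\}$. *)

(* Defs.v *)
From HB Require Import structures.
From mathcomp Require Import all_boot all_order all_algebra.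
From mathcomp Require Import all_classical all_reals all_analysis.

Set Implicit Arguments.
Unset Strict Implicit.
Unset Printing Implicit Defensive.

Import Order.TTheory GRing.Theory Num.Theory.
Import numFieldNormedType.Exports.

Local Open Scope classical_set_scope.
Local Open Scope ring_scope.

(* [f] is C^k on the open set [U].  All directional derivatives are used instead
   of the partial derivatives of a basis, so that the definition applies both to
   'rV[R]_n and to 'rV[R]_n * 'rV[R]_n; in finite dimension the two agree. *)
Fixpoint class_C (R : realType) (V : normedModType R) (U : set V) (k : nat)
    (f : V -> R) : Prop :=
  (forall x, U x -> {for x, continuous f}) /\
  if k is k'.+1 then
    forall v, (forall x, U x -> derivable f x v) /\ class_C U k' ('D_v f)
  else True.

Definition smooth_on (R : realType) (V : normedModType R) (U : set V)
    (f : V -> R) : Prop := forall k, class_C U k f.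

Definition domain (R : realType) (n : nat) (Omega : set 'rV[R]_n) : Prop :=
  [/\ Omega !=set0, open Omega & connected Omega].

Definition unitv (R : realType) (n : nat) (i : 'I_n) : 'rV[R]_n := delta_mx 0 i.

Definition posdefmx (R : realType) (n : nat) (A : 'M[R]_n) : Prop :=
  forall v : 'rV[R]_n, v != 0 -> 0 < (v *m A *m v^T) 0 0.

(* (1/2) d^2 (phi^2) / dy^i dy^j *)
Definition half_hessian_sq (R : realType) (n : nat) (phi : 'rV[R]_n -> R)
    (y : 'rV[R]_n) : 'M[R]_n :=
  \matrix_(i, j)
    (2^-1 * 'D_(unitv R i) ('D_(unitv R j) (fun z => phi z ^+ 2)) y).

Record minkowski_norm (R : realType) (n : nat) (phi : 'rV[R]_n -> R) : Prop :=
  MinkowskiNorm {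
    minkowski_ge0 : forall y, 0 <= phi y;
    minkowski_smooth : smooth_on [set y : 'rV[R]_n | y != 0] phi;
    minkowski_eq0 : forall y, phi y = 0 <-> y = 0;
    minkowski_homog : forall (a : R) y, 0 < a -> phi (a *: y) = a * phi y;
    minkowski_posdef : forall y, y != 0 -> posdefmx (half_hessian_sq phi y)
  }.

(* A function on the tangent bundle Omega * R^n is a total function
   [F : 'rV[R]_n -> 'rV[R]_n -> R] whose values at base points outside [Omega]
   are irrelevant. *)
Definition finsler_metric (R : realType) (n : nat) (Omega : set 'rV[R]_n)
    (F : 'rV[R]_n -> 'rV[R]_n -> R) : Prop :=
  smooth_on [set p : 'rV[R]_n * 'rV[R]_n | Omega p.1 /\ p.2 != 0]
    (fun p => F p.1 p.2) /\
  (forall x, Omega x -> minkowski_norm (F x)).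

Definition fundamental_tensor (R : realType) (n : nat)
    (F : 'rV[R]_n -> 'rV[R]_n -> R) (x y : 'rV[R]_n) : 'M[R]_n :=
  half_hessian_sq (F x) y.

Definition reversibility (R : realType) (n : nat) (Omega : set 'rV[R]_n)
    (F : 'rV[R]_n -> 'rV[R]_n -> R) : \bar R :=
  ereal_sup [set ereal_sup [set (F x (- y) / F x y)%:E
                           | y in [set y : 'rV[R]_n | y != 0]]
            | x in Omega].

(* the vector (G^1, ..., G^n) *)
Definition geodesic_coef (R : realType) (n : nat)
    (F : 'rV[R]_n -> 'rV[R]_n -> R) (x y : 'rV[R]_n) : 'rV[R]_n :=
  \row_i (4^-1 * \sum_j invmx (fundamental_tensor F x y) i j *
    (\sum_l 'D_(unitv R l)
         (fun x' => 'D_(unitv R j) (fun y' => F x' y' ^+ 2) y) x * y 0 l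
     - 'D_(unitv R j) (fun x' => F x' y ^+ 2) x)).

(* The derivative of [c] at [t] relative to the interval [J]: one-sided when [t]
   is an end point of [J], two-sided when [t] is interior. *)
Definition has_deriv_in (R : realType) (n : nat) (J : interval R)
    (c : R -> 'rV[R]_n) (t : R) (v : 'rV[R]_n) : Prop :=
  (s - t)^-1 *: (c s - c t) @[s --> within [set` J] t^'] --> v.

(* The values of [c] outside [J] are irrelevant.  Since F^2 is smooth only away
   from the zero section, the velocity is required not to vanish; constant curves
   are thereby excluded. *)
Definition geodesic (R : realType) (n : nat) (Omega : set 'rV[R]_n)
    (F : 'rV[R]_n -> 'rV[R]_n -> R) (J : interval R) (c : R -> 'rV[R]_n) : Prop :=
  exists v : R -> 'rV[R]_n, forall t, t \in J ->
    [/\ Omega (c t), v t != 0, has_deriv_in J c t (v t)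
      & has_deriv_in J v t (- (2 *: geodesic_coef F (c t) (v t)))].

Definition forward_complete (R : realType) (n : nat) (Omega : set 'rV[R]_n)
    (F : 'rV[R]_n -> 'rV[R]_n -> R) : Prop :=
  forall c, geodesic Omega F `[0, 1[ c ->
    exists2 c', geodesic Omega F `[0, +oo[ c' & {in `[0, 1[, c' =1 c}.

Definition backward_complete (R : realType) (n : nat) (Omega : set 'rV[R]_n)
    (F : 'rV[R]_n -> 'rV[R]_n -> R) : Prop :=
  forall c, geodesic Omega F `]0, 1] c ->
    exists2 c', geodesic Omega F `]-oo, 1] c' & {in `]0, 1], c' =1 c}.

Definition straight_line (R : realType) (n : nat) (L : set 'rV[R]_n) : Prop :=
  exists p d : 'rV[R]_n, d != 0 /\ L = range (fun s : R => p + s *: d).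

Definition projectively_flat (R : realType) (n : nat) (Omega : set 'rV[R]_n)
    (F : 'rV[R]_n -> 'rV[R]_n -> R) : Prop :=
  forall J c, geodesic Omega F J c ->
    exists2 L, straight_line L & c @` [set` J] `<=` L.

(* The density of the Lebesgue measure in the standard coordinates is 1, whence
   no denominator under the logarithm. *)
Definition distortion (R : realType) (n : nat)
    (F : 'rV[R]_n -> 'rV[R]_n -> R) (x y : 'rV[R]_n) : R :=
  ln (Num.sqrt (\det (fundamental_tensor F x y))).

Definition geodesics_from (R : realType) (n : nat) (Omega : set 'rV[R]_n)
    (F : 'rV[R]_n -> 'rV[R]_n -> R) (x y : 'rV[R]_n) : set (R -> 'rV[R]_n) :=
  [set c | [/\ exists2 e : R, 0 < e & geodesic Omega F `]- e, e[ c,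
               c 0 = x & derive1 c 0 = y]].

(* For x in Omega and y != 0 such a geodesic exists, and its germ at 0 is
   unique, by the Cauchy-Lipschitz theorem; the default value is then unused. *)
Definition geodesic_from (R : realType) (n : nat) (Omega : set 'rV[R]_n)
    (F : 'rV[R]_n -> 'rV[R]_n -> R) (x y : 'rV[R]_n) : R -> 'rV[R]_n :=
  xget (fun=> x) (geodesics_from Omega F x y).

Definition S_curvature (R : realType) (n : nat) (Omega : set 'rV[R]_n)
    (F : 'rV[R]_n -> 'rV[R]_n -> R) (x y : 'rV[R]_n) : R :=
  let c := geodesic_from Omega F x y in
  derive1 (fun t : R => distortion F (c t) (derive1 c t)) 0.

Definition S_curvature_ge (R : realType) (n : nat) (Omega : set 'rV[R]_n)
    (F : 'rV[R]_n -> 'rV[R]_n -> R) (a : R) : Prop :=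
  forall x y, Omega x -> y != 0 -> a * F x y <= S_curvature Omega F x y.

(* Main.v *)
Require Import Defs.
From HB Require Import structures.
From mathcomp Require Import all_boot all_order all_algebra.
From mathcomp Require Import all_classical all_reals all_analysis.
From mathcomp Require Import ring lra.
Import Order.TTheory GRing.Theory Num.Theory.
Import numFieldNormedType.Exports.
Local Open Scope classical_set_scope.
Local Open Scope ring_scope.

Set Implicit Arguments.
Unset Strict Implicit.
Unset Printing Implicit Defensive.

(** The proof rests on one differential inequality along straight lines.

    Write [f s = F (x + s *: y) y].  A projectively flat metric has straight
    geodesics, so its spray is collinear with the velocity, [G = P *: y].
    Contracting the definition of the spray with [y] gives [2 P F = D_y F]
    (derivative in the base point), and what is left is Hamel's equation
    [hamel].  Differentiating Hamel's equation once more in the velocity shows that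
    the vertical Hessian of [F] is constant along the line ([vhess_parallel]).  Since
    [g = F *: Hess F + dF^T *m dF], where [Hess F] kills [y] and [dF] takes the value
    [F] on [y], a determinant computation ([det_scale_rank1]) yields that
    [\det g] is a constant multiple of [f ^+ n.+1].  Hence
    [S = (n + 1) / 2 * f' / f] ([S_curvature_line]), and [S >= b F] becomes the Riccati
    inequality [f' >= k * f ^+ 2] with [k = 2 b / (n + 1)], that is [(1 / f)' <= - k].

    Two consequences are used throughout: [f] is nondecreasing, and a segment of
    parameter length [1] in [Omega] forces [f 0 <= 1 / k] ([metric_line_bound]).
    A geodesic on the line is [x + a t *: y] with [a' * f (a t)] constant
    ([geodesic_clairaut]); therefore a forward complete geodesic crosses every
    initial piece of a ray on which [f] is bounded ([forward_reach]).

    - Boundedness.  The points visible from [x] form an open subset of [Omega]; by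
      monotonicity of [f] and [forward_reach] it is closed in [Omega], so it is all of
      [Omega] by connectedness ([star_shaped]).  Every [z] in [Omega] then satisfies
      [F x (z - x) <= 1 / k], and [F x] dominates a multiple of the norm.
    - Backward completeness would give a geodesic whose coordinate speed [a'] is at
      least [K / F x y] at all earlier times, so that it leaves the bounded set [Omega].
    - If the reversibility were finite, [F] would be bounded along backward lines in
      the opposite direction as well, and [forward_reach] applied to the opposite rays
      would make them stay in [Omega] forever.

    No existence theorem for differential equations enters: were there no geodesic
    with initial velocity [y], the S-curvature at [y] would be the derivative of a
    constant, contrary to [S >= b F > 0] ([geodesic_from_in]). *)

(** * Mean values and directional derivatives *)

Section OneVariable.
Context {R : realType}.
Implicit Types g dg : R -> R.

Lemma MVT_is_derive g dg (a b : R) : a < b ->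
  (forall t : R, a <= t <= b -> is_derive t 1 g (dg t)) ->
  exists2 c, a < c < b & g b - g a = dg c * (b - a).
Proof.
move=> ab dgP; have [||c + cE] := @MVT R g dg a b ab.
- by move=> t; rewrite in_itv/= => /andP[/ltW ? /ltW ?]; apply/dgP/andP.
- apply: derivable_within_continuous => t; rewrite in_itv/= => tab.
  by have [] := dgP t tab.
- by rewrite in_itv/=; exists c.
Qed.

(** Centred form of the mean value theorem: it treats increments of either sign
    at once, as difference quotients require. *)
Lemma MVT0 g dg (t : R) :
  (forall s : R, `|s| <= `|t| -> is_derive s 1 g (dg s)) ->
  exists2 c, `|c| <= `|t| & g t - g 0 = dg c * t.
Proof.
move=> dgP; case: (ltgtP t 0) => [t0|t0|->]; last first.
- by exists 0 => //; rewrite subrr mulr0.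
- have [s st|c /andP[c0 ct] cE] := @MVT_is_derive g dg 0 t t0.
    by case/andP: st => s0 st; apply: dgP; rewrite !ger0_norm// ltW.
  by exists c; rewrite ?cE ?subr0// !gtr0_norm// ltW.
- have [s st|c /andP[ct c0] cE] := @MVT_is_derive g dg t 0 t0.
    by case/andP: st => st s0; apply: dgP; rewrite !ler0_norm ?lerN2// ltW.
  exists c; first by rewrite !ltr0_norm// lerN2 ltW.
  by rewrite -opprB cE sub0r mulrN opprK.
Qed.

End OneVariable.

Section DirectionalDerivatives.
Context {R : realType} {V : normedModType R}.
Implicit Types (f g : V -> R) (U : set V).

Lemma is_derive_line f p v t : derivable f (p + t *: v) v ->
  is_derive t 1 (fun s => f (p + s *: v)) ('D_v f (p + t *: v)).
Proof.
move=> df.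
have E : (fun h : R => h^-1 *: (f (p + (h *: (1:R) + t) *: v) - f (p + t *: v)))
   = (fun h => h^-1 *: (f (h *: v + (p + t *: v)) - f (p + t *: v))).
  apply/funext => h; congr (_ *: (f _ - _)).
  by rewrite scalerDl [h *: 1]mulr1 addrCA.
by apply: DeriveDef; rewrite /derivable/derive/= E.
Qed.

Lemma is_derive_line0 f p v (d : R) :
  is_derive (0 : R) (1 : R) (fun h : R => f (p + h *: v)) d -> is_derive p v f d.
Proof.
have E : (fun h : R => h^-1 *: (f (p + (h *: (1:R) + 0) *: v) - f (p + 0 *: v)))
   = (fun h => h^-1 *: (f (h *: v + p) - f p)).
  by apply/funext => h; rewrite scale0r !addr0 [h *: 1]mulr1 [p + h *: _]addrC.
move=> [df dfE]; apply: DeriveDef.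
  by move: df; rewrite /derivable/= E.
by move: dfE; rewrite /derive/= E.
Qed.

Lemma is_deriveZ_dir f p (c : R) v :
  derivable f p v -> is_derive p (c *: v) f (c * 'D_v f p).
Proof.
move=> df; apply: is_derive_line0.
have dc : is_derive (0 : R) (1 : R) (fun h : R => h * c) c.
  by apply: is_derive_eq; rewrite scaler0 add0r [_ *: _]mulr1.
have dl : is_derive (0 * c : R) (1 : R) (fun s : R => f (p + s *: v)) ('D_v f p).
  have := @is_derive_line f p v 0; rewrite mul0r scale0r addr0; exact.
have := @is_derive1_comp R (fun s => f (p + s *: v)) (fun h => h * c) 0 _ _ dl dc.
by rewrite mulrC; apply: near_eq_is_derive; near=> h; rewrite /= scalerA.
Unshelve. all: by end_near. Qed.

(** Strict differentiability along [b]: by the mean value theorem, increments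
    of [g] along [b] based at any point near [x] are governed by the single number
    ['D_b g x]. *)
Lemma strict_derive U g b x : open U -> U x ->
  (forall p : V, U p -> derivable g p b) -> {for x, continuous ('D_b g)} ->
  forall e, 0 < e -> exists2 d, 0 < d & forall w h, `|w| < d -> `|h| < d ->
    `|g (x + w + h *: b) - g (x + w) - h * 'D_b g x| <= e * `|h|.
Proof.
move=> oU Ux dg cg e e0.
have /nbhs_ballP[r /= r0 rP] : nbhs x (fun p => U p /\ `|'D_b g x - 'D_b g p| < e).
  apply: filterI; first exact: open_nbhs_nbhs.
  by have /cvgrPdist_lt/(_ _ e0) := cg.
pose m := 1 + `|b|; have m0 : 0 < m by rewrite ltr_pwDl.
exists (r / (2 * m)) => [|w h wd hd]; first by rewrite divr_gt0// mulr_gt0.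
have inr s : `|s| <= `|h| -> ball x r (x + w + s *: b).
  move=> sh; rewrite -ball_normE /ball_/= -addrA opprD addNKr normrN.
  apply: (le_lt_trans (ler_normD _ _)); rewrite normrZ.
  have wr : `|w| < r / 2.
    apply: (lt_le_trans wd); rewrite ler_pM2l// lef_pV2 ?posrE ?mulr_gt0//.
    by rewrite ler_peMr// lerDl.
  have : `|s| * `|b| <= r / (2 * m) * m.
    by apply: ler_pM => //; [exact: le_trans sh (ltW hd) | rewrite lerDr].
  rewrite invfM mulrA mulfVK ?gt_eqF// => sb.
  by rewrite [ltRHS]splitr ltr_leD.
have [s sh|c ch] := @MVT0 R (fun s => g (x + w + s *: b))
    (fun s => 'D_b g (x + w + s *: b)) h.
  by apply/is_derive_line/dg; case: (rP _ (inr s sh)).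
rewrite scale0r addr0 => ->; rewrite [h * _]mulrC -mulrBl normrM ler_wpM2r//.
by rewrite distrC ltW//; case: (rP _ (inr c ch)).
Qed.

End DirectionalDerivatives.

(** * Smooth functions: linearity and symmetry of derivatives *)

Section SmoothFunctions.
Context {R : realType} {V : normedModType R}.
Implicit Types (f : V -> R) (U : set V).

Lemma smooth_continuous U f p : smooth_on U f -> U p -> {for p, continuous f}.
Proof. by move=> /(_ 0)[+ _]; exact. Qed.

Lemma smooth_derivable U f p v : smooth_on U f -> U p -> derivable f p v.
Proof. by move=> /(_ 1)[_ /(_ v)[+ _]]; exact. Qed.

Lemma smooth_derive U f v : smooth_on U f -> smooth_on U ('D_v f).
Proof. by move=> sf k; have [_ /(_ v)[]] := sf k.+1. Qed.

(** Telescoping: the increment along [a + b] is the one along [a] followed by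
    one along [b] from a displaced point, which [strict_derive] controls. *)
Lemma derive_dirD U f p a b : open U -> smooth_on U f -> U p ->
  'D_(a + b) f p = 'D_a f p + 'D_b f p.
Proof.
move=> oU sf Up; apply: cvg_lim => //.
rewrite [X in X @ _ --> _](_ : _ = (fun h : R => h^-1 *: (f (h *: a + p) - f p) +
   h^-1 *: (f (h *: (a + b) + p) - f (h *: a + p)))); last first.
  apply/funext => h; rewrite -scalerDr; congr (_ *: _).
  by rewrite [RHS]addrC addrA subrK.
have da : derivable f p a := smooth_derivable sf Up.
apply: cvgD; first by apply: cvg_trans da; near_simpl. 
apply/cvgrPdist_le => e e0.
have [d d0 dP] := strict_derive (b := b) oU Up
  (fun q Uq => smooth_derivable sf Uq)
  (smooth_continuous (smooth_derive b sf) Up) e0.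
have a1 : 0 < 1 + `|a| by rewrite ltr_pwDl.
near=> h; have h0 : h != 0 by near: h; exact: nbhs_dnbhs_neq.
have hda : `|h| < d / (1 + `|a|).
  by near: h; apply: (@dnbhs0_lt _ R^o) => //; exact: divr_gt0.
have hd : `|h| < d.
  by apply: (lt_le_trans hda); rewrite ler_pdivrMr// ler_peMr ?(ltW d0)// lerDl.
have had : `|h *: a| < d.
  rewrite normrZ; move: hda; rewrite ltr_pdivlMr//; apply: le_lt_trans.
  by rewrite ler_wpM2l// lerDr.
have := dP _ _ had hd.
rewrite -ler_pdivrMr ?normr_gt0// => /(le_trans _); apply.
rewrite -normfV -normrM distrC.
rewrite (_ : p + h *: a + h *: b = h *: (a + b) + p); last by rewrite scalerDr [RHS]addrC addrA.
by rewrite [p + _]addrC mulrC mulrBr mulKf.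
Unshelve. all: by end_near. Qed.

Lemma derive_sum_dir U f p (I : Type) (r : seq I) (c : I -> R) (v : I -> V) :
  open U -> smooth_on U f -> U p ->
  'D_(\sum_(i <- r) c i *: v i) f p = \sum_(i <- r) c i * 'D_(v i) f p.
Proof.
move=> oU sf Up; elim: r => [|i r IH]; first by rewrite !big_nil derive0.
rewrite !big_cons (derive_dirD _ _ oU sf)// IH; congr (_ + _).
by have [] := is_deriveZ_dir (c i) (smooth_derivable (v := v i) sf Up).
Qed.

(** The second difference of [f] over the parallelogram spanned by [h *: a] and
    [h *: b], divided by [h ^+ 2], tends to the mixed derivative: the mean value
    theorem along [a] reduces it to an increment of ['D_a f] along [b]. *)
Lemma second_difference U f p a b : open U -> smooth_on U f -> U p ->
  forall e, 0 < e -> \forall h \near 0^',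
    `|(f (p + h *: a + h *: b) - f (p + h *: a) - f (p + h *: b) + f p) / h ^+ 2
      - 'D_b ('D_a f) p| <= e.
Proof.
move=> oU sf Up e e0.
have [d d0 dP] := strict_derive (b := b) oU Up
  (fun q Uq => smooth_derivable (smooth_derive a sf) Uq)
  (smooth_continuous (smooth_derive b (smooth_derive a sf)) Up) e0.
have /nbhs_ballP[r /= r0 rP] : nbhs p U by exact: open_nbhs_nbhs.
pose m := 1 + (`|a| + `|b|).
have m0 : 0 < m by rewrite ltr_pwDl// addr_ge0.
near=> h; have h0 : h != 0 by near: h; exact: nbhs_dnbhs_neq.
have hd : `|h| < d by near: h; apply: (@dnbhs0_lt _ R^o).
have hdm : `|h| < d / m.
  by near: h; apply: (@dnbhs0_lt _ R^o) => //; exact: divr_gt0.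
have hrm : `|h| < r / m.
  by near: h; apply: (@dnbhs0_lt _ R^o) => //; exact: divr_gt0.
have small (s t : R) (q : R) : `|s| <= `|h| -> `|t| <= `|h| -> `|h| < q / m ->
    `|s *: a + t *: b| < q.
  move=> sh th; rewrite ltr_pdivlMr//; apply: le_lt_trans.
  apply: (le_trans (ler_normD _ _)); rewrite !normrZ mulrDr mulr1 mulrDr.
  by rewrite ler_wpDl// lerD// ler_wpM2r.
have Uin (s t : R) : `|s| <= `|h| -> `|t| <= `|h| -> U (p + s *: a + t *: b).
  move=> sh th; apply: rP; rewrite -ball_normE /ball_/= -addrA opprD addNKr normrN.
  exact: small.
have [s sh|c ch] := @MVT0 R
    (fun s => f (p + h *: b + s *: a) - f (p + s *: a))
    (fun s => 'D_a f (p + h *: b + s *: a) - 'D_a f (p + s *: a)) h.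
  apply: is_deriveB.
    apply/is_derive_line/(smooth_derivable sf).
    by rewrite addrAC; apply: Uin.
  apply/is_derive_line/(smooth_derivable sf).
  by have := @Uin s 0 sh; rewrite scale0r addr0 normr0; apply.
rewrite scale0r !addr0 => cE.
have cad : `|c *: a| < d.
  by have := @small c 0 d ch; rewrite scale0r addr0 normr0; apply.
have := dP _ _ cad hd.
rewrite addrAC [p + c *: a + _]addrAC.
rewrite -ler_pdivrMr ?normr_gt0// => /(le_trans _); apply.
rewrite -normfV -normrM le_eqVlt; apply/orP; left; apply/eqP; congr `|_|.
rewrite [p + h *: a + _]addrAC.
have alg (A B D k : R) : k != 0 -> (A - B) * k / k ^+ 2 - D = (A - k * D - B) / k.
  by move=> k0; field.
by rewrite -alg// -cE opprB addrA [_ - f (p + h *: b) + _]addrAC.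
Unshelve. all: by end_near. Qed.

(** Both mixed derivatives are limits of the same second difference. *)
Lemma derive_comm U f p a b : open U -> smooth_on U f -> U p ->
  'D_a ('D_b f) p = 'D_b ('D_a f) p.
Proof.
move=> oU sf Up; apply/eqP; rewrite -subr_eq0 -normr_le0.
apply/ler_addgt0Pl => e e0; rewrite addr0.
have e2 : 0 < e / 2 by rewrite divr_gt0.
have nab := filterI (@second_difference U f p a b oU sf Up _ e2)
  (@second_difference U f p b a oU sf Up _ e2).
have [h [Hab Hba]] := filter_ex (nab _).
rewrite (addrAC p (h *: b)) (addrAC _ (- f (p + h *: b))) distrC in Hba.
rewrite [leRHS]splitr; apply: le_trans (lerD Hba Hab).
by rewrite (le_trans _ (ler_normD _ _))// addrA subrK.
Qed.

End SmoothFunctions.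

Section SquaresAndLines.
Context {R : realType} {V : normedModType R}.
Implicit Types (f g : V -> R) (U : set V).

Lemma near_line U (p v : V) : open U -> U p -> \forall h \near (0 : R), U (p + h *: v).
Proof.
move=> oU Up; have : (fun h : R => p + h *: v) @ (0 : R) --> p + (0 : R) *: v.
  by apply: cvgD; [exact: cvg_cst | apply: cvgZr_tmp; exact: cvg_id].
by apply; rewrite scale0r addr0; exact: open_nbhs_nbhs.
Qed.

(** A directional derivative only sees the restriction to a line, whence identities
    that hold on one line can be differentiated along it. *)
Lemma near_line_eq_derive f g p v :
  (\forall h \near (0 : R), f (p + h *: v) = g (p + h *: v)) -> 'D_v f p = 'D_v g p.
Proof.
move=> fg; have fgp := nbhs_singleton fg; rewrite scale0r addr0 in fgp.
rewrite /derive; congr (lim _).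
rewrite eqEsubset; split; apply/near_eq_cvg/cvg_within.
  by near=> h; rewrite /= ![h *: v + p]addrC fgp; congr (_ *: (_ - _)); near: h.
by near=> h; rewrite /= ![h *: v + p]addrC fgp; congr (_ *: (_ - _)); apply/esym; near: h.
Unshelve. all: by end_near. Qed.

Lemma derive_sqr U f p v : open U -> smooth_on U f -> U p ->
  'D_v (fun q => f q ^+ 2) p = 2 * (f p * 'D_v f p).
Proof.
move=> oU sf Up; have df : derivable f p v := smooth_derivable sf Up.
have [_ ->] : is_derive p v (fun q => f q ^+ 2) (2 * f p ^+ 1 *: 'D_v f p).
  exact: (is_deriveX 2 (derivableP df)).
by rewrite expr1 mulrA.
Qed.

Lemma derive_derive_sqr U f p u v : open U -> smooth_on U f -> U p ->
  'D_u ('D_v (fun q => f q ^+ 2)) p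
    = 2 * ('D_u f p * 'D_v f p + f p * 'D_u ('D_v f) p).
Proof.
move=> oU sf Up.
rewrite (@near_line_eq_derive _ (fun q => 2 * (f q * 'D_v f q))); last first.
  by apply: filterS (near_line u oU Up) => h Uh; exact: derive_sqr sf Uh.
have df : derivable f p u := smooth_derivable sf Up.
have ddf : derivable ('D_v f) p u := smooth_derivable (smooth_derive v sf) Up.
have [_ ->] : is_derive p u (fun q => 2 * (f q * 'D_v f q))
    (2 *: (f p *: 'D_u ('D_v f) p + 'D_v f p *: 'D_u f p)).
  exact: (is_deriveZ 2 (is_deriveM (derivableP df) (derivableP ddf))).
by congr (2 * _); rewrite addrC; congr (_ + _); exact: mulrC.
Qed.

End SquaresAndLines.

(** * Determinants of rank-one perturbations *)

Section RankOneDeterminant.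
Context {K : fieldType} {n : nat}.
Implicit Types (A : 'M[K]_n) (p q y : 'rV[K]_n).

(** Both sides are the determinant of the same block matrix, eliminated in two
    ways. *)
Lemma det_1D_rank1 (u : 'cV[K]_n) (v : 'rV[K]_n) :
  \det (1%:M + u *m v) = 1 + (v *m u) 0 0.
Proof.
have E1 : \det (block_mx (1%:M : 'M[K]_1) (- v) u 1%:M) = \det (1%:M + u *m v).
  have : block_mx (1%:M : 'M[K]_1) 0 (- u) 1%:M *m block_mx 1%:M (- v) u 1%:M
      = block_mx 1%:M (- v) 0 (1%:M + u *m v).
    rewrite mulmx_block !mul1mx !mul0mx !mulmx1 addr0 addr0 addNr.
    by rewrite mulmxN mulNmx opprK addrC.
  move/(congr1 determinant); rewrite det_mulmx det_lblock !det1 det_ublock det1.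
  by rewrite !mul1r.
have E2 : \det (block_mx (1%:M : 'M[K]_1) (- v) u 1%:M) = 1 + (v *m u) 0 0.
  have : block_mx (1%:M : 'M[K]_1) v 0 1%:M *m block_mx 1%:M (- v) u 1%:M
      = block_mx (1%:M + v *m u) 0 u 1%:M.
    rewrite mulmx_block !mul1mx !mul0mx !mulmx1 add0r.
    by rewrite addNr add0r.
  move/(congr1 determinant); rewrite det_mulmx det_ublock !det1 det_lblock det1.
  by rewrite !mul1r mulr1 det_mx11 => ->; rewrite !mxE eqxx.
by rewrite -E1 E2.
Qed.

(** If [y] is in the left and right kernels of [A], every form
    [f *: A + p^T *m p] with [p] of value [f] on [y] is obtained from
    [A + q^T *m q] by the shear [1 + y^T *m w] that carries [f *: q] to [p] and by
    a scaling by [f], twice over in the direction [y]. *)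
Lemma det_scale_rank1 A p q y (f : K) : f != 0 ->
  A *m y^T = 0 -> y *m A = 0 -> p *m y^T = f%:M -> q *m y^T = 1%:M ->
  \det (f *: A + p^T *m p) = f ^+ n.+1 * \det (A + q^T *m q).
Proof.
move=> f0 Ay yA py qy.
have yq : y *m q^T = 1%:M by rewrite -[LHS]trmxK trmx_mul !trmxK qy trmx1.
pose w := f^-1 *: (p - f *: q).
have wy : w *m y^T = 0.
  by rewrite -scalemxAl mulmxBl -scalemxAl py qy scalemx1 subrr scaler0.
(* T is the shear; its determinant is 1 because w vanishes on y. *)
pose T := 1%:M + y^T *m w.
have detT : \det T = 1 by rewrite det_1D_rank1 wy mxE addr0.
have AT : A *m T = A by rewrite mulmxDr mulmx1 mulmxA Ay mul0mx addr0.
have TA : T^T *m A = A.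
  by rewrite linearD/= trmx1 trmx_mul trmxK mulmxDl mul1mx -mulmxA yA mulmx0 addr0.
have qT : f *: q *m T = p.
  rewrite mulmxDr mulmx1 mulmxA -scalemxAl qy -scalemxAl mul1mx scalerA divff//.
  by rewrite scale1r addrC subrK.
have Tq : T^T *m (f *: q)^T = p^T by rewrite -trmx_mul qT.
have -> : f *: A + p^T *m p = T^T *m (f *: A + (f *: q)^T *m (f *: q)) *m T.
  rewrite [T^T *m _]mulmxDr [RHS]mulmxDl -scalemxAr TA -scalemxAl AT; congr (_ + _).
  by rewrite mulmxA Tq -mulmxA qT.
rewrite !det_mulmx det_tr detT mul1r mulr1.
pose D := f *: (1%:M + ((f - 1) *: y^T) *m q).
have -> : f *: A + (f *: q)^T *m (f *: q) = (A + q^T *m q) *m D.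
  rewrite /D -[RHS]scalemxAr [in RHS]mulmxDr mulmx1 mulmxA [in RHS]mulmxDl -!scalemxAr Ay scaler0 add0r.
  rewrite -[q^T *m q *m y^T]mulmxA qy mulmx1 -[in RHS]scalemxAl -addrA.
  rewrite -[X in A + (X + _)]scale1r -scalerDl [1 + _]addrC subrK scalerDr.
  by rewrite linearZ/= -scalemxAl.
rewrite det_mulmx mulrC; congr (_ * _).
rewrite detZ det_1D_rank1 -scalemxAr qy !mxE eqxx mulr1 exprSr; congr (_ * _).
by rewrite addrC subrK.
Qed.

End RankOneDeterminant.

(** * Finsler metrics: Hamel's equation and the determinant of the metric *)

Lemma sym_antisym_eq0 {R : realDomainType} (a a' b c : R) :
  a = a' -> a = c - b -> a' = b - c -> a = 0.
Proof. by move=> ?? ?; lra. Qed.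

Lemma add_eq_subr {V : zmodType} (a b c : V) : a + c = b -> a = b - c.
Proof. by move=> <-; rewrite addrK. Qed.

Lemma eq_ratio_exp {K : fieldType} (k : nat) (a b c A B : K) :
  b != 0 -> A = a ^+ k * c -> B = b ^+ k * c -> A = (a / b) ^+ k * B.
Proof. by move=> b0 -> ->; rewrite expr_div_n mulrA divfK// expf_neq0. Qed.

Lemma sum_collinear {R : comPzRingType} (I : finType) (y p b c : I -> R) (a d : R) :
  \sum_j y j * (a * p j + d * (b j - c j))
  = a * (\sum_j p j * y j) + d * (\sum_j b j * y j - \sum_j c j * y j).
Proof.
by rewrite -sumrB !mulr_sumr -big_split; apply: eq_bigr => j _ /=; ring.
Qed.

(** Sealed, so that comparing two gradients means comparing base points and not
    the limits behind the derivatives; likewise for [vhess]. *)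
HB.lock Definition vgrad {R : realType} {n : nat} (F : 'rV[R]_n -> 'rV[R]_n -> R)
    (x y : 'rV[R]_n) : 'rV[R]_n :=
  \row_j 'D_((0, unitv R j) : 'rV[R]_n * 'rV[R]_n) (fun p => F p.1 p.2) (x, y).

HB.lock Definition vhess {R : realType} {n : nat} (F : 'rV[R]_n -> 'rV[R]_n -> R)
    (x y : 'rV[R]_n) : 'M[R]_n :=
  \matrix_(i, j) 'D_((0, unitv R i) : 'rV[R]_n * 'rV[R]_n)
    ('D_((0, unitv R j) : 'rV[R]_n * 'rV[R]_n) (fun p => F p.1 p.2)) (x, y).

Section FinslerMetrics.
Context {R : realType} {n : nat}.
Variables (Omega : set 'rV[R]_n) (F : 'rV[R]_n -> 'rV[R]_n -> R).
Hypotheses (oOmega : open Omega) (hF : finsler_metric Omega F).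
Implicit Types x y u v : 'rV[R]_n.

Local Notation W := ('rV[R]_n * 'rV[R]_n)%type.
Local Notation f := (fun p : W => F p.1 p.2).
Local Notation U := [set p : W | Omega p.1 /\ p.2 != 0].
Local Notation hor u := ((u, 0) : W).
Local Notation ver u := ((0, u) : W).

Lemma open_slit : open U.
Proof.
have -> : U = fst @^-1` Omega `&` snd @^-1` ~` [set (0 : 'rV[R]_n)].
  by apply/seteqP; split => p [Op p0]; split => //; apply/eqP.
apply: openI.
  by apply: (@open_comp _ _ fst) => // p _; apply: cvg_fst.
apply: (@open_comp _ _ snd) => [p _|]; first exact: cvg_snd.
apply: closed_openC; apply: accessible_closed_set1; exact: hausdorff_accessible (@norm_hausdorff _ _).
Qed.

Lemma finsler_smooth : smooth_on U f. Proof. by case: hF. Qed.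

Lemma finsler_pos x y : Omega x -> y != 0 -> 0 < F x y.
Proof.
move=> Ox y0; have [F0 _ Feq _ _] := hF.2 x Ox.
rewrite lt_def F0 andbT; apply: contraNN y0 => /eqP/Feq ->; exact: eqxx.
Qed.

Lemma finsler_homog x y (a : R) : Omega x -> 0 < a -> F x (a *: y) = a * F x y.
Proof. by move=> Ox a0; have [_ _ _ + _] := hF.2 x Ox; exact. Qed.

Lemma derive_ver (g : W -> R) x y u : 'D_u (fun z => g (x, z)) y = 'D_(ver u) g (x, y).
Proof.
have E : (fun h : R => h^-1 *: (g (x, h *: u + y) - g (x, y))) =
    (fun h => h^-1 *: (g (h *: ver u + (x, y)) - g (x, y))).
  by apply/funext => h; congr (_ *: (g (_, _) - _)); rewrite /= scaler0 add0r.
by rewrite /derive/= E.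
Qed.

Lemma derive_hor (g : W -> R) x y u : 'D_u (fun z => g (z, y)) x = 'D_(hor u) g (x, y).
Proof.
have E : (fun h : R => h^-1 *: (g (h *: u + x, y) - g (x, y))) =
    (fun h => h^-1 *: (g (h *: hor u + (x, y)) - g (x, y))).
  by apply/funext => h; congr (_ *: (g (_, _) - _)); rewrite /= scaler0 add0r.
by rewrite /derive/= E.
Qed.

Lemma ver_sum y : ver y = \sum_i y 0 i *: ver (unitv R i).
Proof.
rewrite {1}[y]row_sum_delta; elim/big_rec2: _ => // i a b _ <-.
by congr (_, _); rewrite /= scaler0 addr0.
Qed.

Lemma hor_sum y : hor y = \sum_i y 0 i *: hor (unitv R i).
Proof.
rewrite {1}[y]row_sum_delta; elim/big_rec2: _ => // i a b _ <-.
by congr (_, _); rewrite /= scaler0 addr0.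
Qed.

Lemma near_pos_dilation : \forall h \near (0 : R), 0 < 1 + h.
Proof.
near=> h; have : `|h| < 1 by near: h; exact: (@nbhs0_lt _ R^o).
by rewrite ltr_norml => /andP[+ _]; rewrite -ltrBlDl sub0r.
Unshelve. all: by end_near. Qed.

Lemma ver_line x y u (h : R) : (x, y) + h *: ver u = (x, y + h *: u).
Proof. by congr (_, _); rewrite /= ?scaler0 ?addr0. Qed.

Lemma dilation_line x y (h : R) : (x, y) + h *: ver y = (x, (1 + h) *: y).
Proof. by congr (_, _) => /=; rewrite ?scaler0 ?addr0// scalerDl scale1r. Qed.

(** Euler's identity for functions that are positively homogeneous of degree 1. *)
Lemma euler_identity x y : Omega x -> 'D_(ver y) f (x, y) = F x y.
Proof.
move=> Ox; have dh : is_derive (0 : R) (1 : R) (fun h : R => (1 + h) * F x y) (F x y).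
  by apply: is_derive_eq; rewrite scaler0 !add0r [_ *: _]mulr1.
have [_ ->] // : is_derive (x, y) (ver y) f (F x y).
apply: is_derive_line0; apply: near_eq_is_derive dh.
by apply: filterS near_pos_dilation => h h0; rewrite dilation_line finsler_homog.
Qed.

Lemma derive_ver_homog (g : W -> R) x y u (a c : R) : smooth_on U g ->
  Omega x -> y != 0 -> 0 < a ->
  (forall z, z != 0 -> g (x, a *: z) = c * g (x, z)) ->
  'D_(ver u) g (x, a *: y) = c / a * 'D_(ver u) g (x, y).
Proof.
move=> sg Ox y0 a0 gh; have an0 : a != 0 by rewrite gt_eqF.
have dg w : derivable g (x, y) w by exact: (smooth_derivable sg).
have E : 'D_(ver (a^-1 *: u)) g (x, y) = a^-1 * 'D_(ver u) g (x, y).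
  have [_ <-] := is_deriveZ_dir a^-1 (dg (ver u)).
  by congr ('D__ g _); congr (_, _); rewrite /= scaler0.
have [_ ->] : is_derive (x, a *: y) (ver u) g (c * 'D_(ver (a^-1 *: u)) g (x, y)).
  apply: is_derive_line0.
  have dl : is_derive (0 : R) (1 : R) (fun h : R => c * g ((x, y) + h *: ver (a^-1 *: u)))
      (c * 'D_(ver (a^-1 *: u)) g (x, y)).
    apply: is_deriveZ.
    have := @is_derive_line _ _ g (x, y) (ver (a^-1 *: u)) 0.
    by rewrite scale0r addr0; apply.
  apply: near_eq_is_derive dl.
  have Uxy : U (x, y) by [].
  apply: filterS (near_line (ver (a^-1 *: u)) open_slit Uxy) => h [_ /= Uh].
  rewrite !ver_line -gh//; congr (g (x, _)).
  by rewrite scalerDr !scalerA mulrAC divff// mul1r.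
by rewrite E mulrA.
Qed.

Lemma derive_ver_dilation x y u (a : R) : Omega x -> y != 0 -> 0 < a ->
  'D_(ver u) f (x, a *: y) = 'D_(ver u) f (x, y).
Proof.
move=> Ox y0 a0; rewrite (derive_ver_homog (c := a) _ finsler_smooth)//.
  by rewrite divff ?mul1r// gt_eqF.
by move=> z _ /=; exact: finsler_homog.
Qed.

Lemma derive_ver_euler x y u : Omega x -> y != 0 ->
  'D_(ver y) ('D_(ver u) f) (x, y) = 0.
Proof.
move=> Ox y0; rewrite (@near_line_eq_derive _ _ _ (cst ('D_(ver u) f (x, y)))).
  exact: derive_cst.
apply: filterS near_pos_dilation => h h0.
by rewrite dilation_line derive_ver_dilation.
Qed.

Lemma derive_ver_sum x y u (g : W -> R) : smooth_on U g -> Omega x -> y != 0 ->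
  \sum_i 'D_(ver (unitv R i)) g (x, y) * u 0 i = 'D_(ver u) g (x, y).
Proof.
move=> sg Ox y0; rewrite [ver u]ver_sum (derive_sum_dir _ _ _ open_slit sg)//.
by apply: eq_bigr => i _; rewrite mulrC.
Qed.

Lemma derive_hor_sum x y u (g : W -> R) : smooth_on U g -> Omega x -> y != 0 ->
  \sum_i 'D_(hor (unitv R i)) g (x, y) * u 0 i = 'D_(hor u) g (x, y).
Proof.
move=> sg Ox y0; rewrite [hor u]hor_sum (derive_sum_dir _ _ _ open_slit sg)//.
by apply: eq_bigr => i _; rewrite mulrC.
Qed.

Local Notation vgrad := (vgrad F).
Local Notation vhess := (vhess F).

Lemma vgradE x y j : vgrad x y 0 j = 'D_(ver (unitv R j)) f (x, y).
Proof. by rewrite vgrad.unlock mxE. Qed.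

Lemma vhessE x y i j :
  vhess x y i j = 'D_(ver (unitv R i)) ('D_(ver (unitv R j)) f) (x, y).
Proof. by rewrite vhess.unlock mxE. Qed.

Lemma vgrad_euler x y : Omega x -> y != 0 -> vgrad x y *m y^T = (F x y)%:M.
Proof.
move=> Ox y0; apply/rowP => i; rewrite !mxE !ord1 eqxx mulr1n -[RHS]euler_identity//.
rewrite -(derive_ver_sum _ finsler_smooth)//.
by apply: eq_bigr => j _; rewrite mxE vgradE.
Qed.

Lemma vhess_sym x y : Omega x -> y != 0 -> (vhess x y)^T = vhess x y.
Proof.
move=> Ox y0; apply/matrixP => i j; rewrite mxE !vhessE.
by apply: (derive_comm _ _ open_slit finsler_smooth).
Qed.

Lemma vhess_euler x y : Omega x -> y != 0 -> y *m vhess x y = 0.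
Proof.
move=> Ox y0; apply/rowP => j; rewrite !mxE -[RHS](derive_ver_euler (unitv R j) Ox y0).
rewrite -(derive_ver_sum _ (smooth_derive _ finsler_smooth))//.
by apply: eq_bigr => i _; rewrite vhessE mulrC.
Qed.

Lemma vhess_eulerT x y : Omega x -> y != 0 -> vhess x y *m y^T = 0.
Proof.
by move=> Ox y0; rewrite -vhess_sym// -trmx_mul vhess_euler// trmx0.
Qed.

Lemma fundamental_tensorE x y : Omega x -> y != 0 ->
  fundamental_tensor F x y = F x y *: vhess x y + (vgrad x y)^T *m vgrad x y.
Proof.
move=> Ox y0; apply/matrixP => i j; rewrite !mxE big_ord1 !mxE vhessE !vgradE.
rewrite (_ : (fun y' => _) = fun y' => 'D_(ver (unitv R j)) (fun q : W => f q ^+ 2) (x, y')).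
  rewrite (derive_ver ('D_(ver (unitv R j)) (fun q : W => f q ^+ 2))) (derive_derive_sqr _ _ open_slit finsler_smooth)//.
  by rewrite mulrA mulVf ?pnatr_eq0// mul1r addrC.
by apply/funext => y'; exact: (derive_ver (fun q : W => f q ^+ 2)).
Qed.

(** A row vector in the kernel would be isotropic for the positive definite form. *)
Lemma fundamental_tensor_unit x y : Omega x -> y != 0 ->
  fundamental_tensor F x y \in unitmx.
Proof.
move=> Ox y0; have pd := minkowski_posdef (hF.2 x Ox) y0.
rewrite -row_free_unit -kermx_eq0; apply/eqP/row_matrixP => i; rewrite row0.
apply/eqP; apply: contraT => v0; have := pd _ v0.
by rewrite -row_mul mulmx_ker row0 mul0mx mxE ltxx.
Qed.

Lemma fundamental_tensor_euler x y : Omega x -> y != 0 ->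
  fundamental_tensor F x y *m y^T = F x y *: (vgrad x y)^T.
Proof.
move=> Ox y0; rewrite fundamental_tensorE// mulmxDl -scalemxAl vhess_eulerT// scaler0 add0r.
by rewrite -mulmxA vgrad_euler// mul_mx_scalar.
Qed.

(** The definition of the spray multiplied by the fundamental tensor, and
    expanded in [F] rather than its square. *)
Lemma geodesic_coef_collinear x y (P : R) j : Omega x -> y != 0 ->
  geodesic_coef F x y = P *: y ->
  'D_(hor y) f (x, y) * vgrad x y 0 j
    + F x y * ('D_(hor y) ('D_(ver (unitv R j)) f) (x, y)
      - 'D_(hor (unitv R j)) f (x, y))
  = 2 * P * F x y * vgrad x y 0 j.
Proof.
move=> Ox y0 GP.
pose w : 'rV[R]_n := \row_j
    (\sum_l 'D_(unitv R l)
         (fun x' => 'D_(unitv R j) (fun y' => F x' y' ^+ 2) y) x * y 0 l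
     - 'D_(unitv R j) (fun x' => F x' y ^+ 2) x).
have GE : (geodesic_coef F x y)^T = 4^-1 *: (invmx (fundamental_tensor F x y) *m w^T).
  apply/colP => i; rewrite !mxE; congr (_ * _).
  by apply: eq_bigr => k _; rewrite !mxE.
have wE : w^T = (4 * P * F x y) *: (vgrad x y)^T.
  have -> : w^T = 4 *: (fundamental_tensor F x y *m (geodesic_coef F x y)^T).
    rewrite GE -scalemxAr mulmxA mulmxV ?fundamental_tensor_unit// mul1mx.
    by rewrite scalerA divff ?pnatr_eq0// scale1r.
  by rewrite GP linearZ/= -scalemxAr fundamental_tensor_euler// !scalerA.
have := congr1 (fun M : 'cV[R]_n => M j 0) wE; rewrite !mxE.
rewrite (_ : 'D__ _ x = 2 * (F x y * 'D_(hor (unitv R j)) f (x, y))); last first.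
  by rewrite (derive_hor (fun q : W => f q ^+ 2)) (derive_sqr _ open_slit finsler_smooth).
rewrite (eq_bigr (fun l => 2 * ('D_(hor (unitv R l)) f (x, y) * y 0 l * vgrad x y 0 j
  + F x y * ('D_(hor (unitv R l)) ('D_(ver (unitv R j)) f) (x, y) * y 0 l)))); last first.
  move=> l _.
  rewrite (_ : (fun x' => _) = fun x' => 'D_(ver (unitv R j)) (fun q : W => f q ^+ 2) (x', y)).
    rewrite (derive_hor ('D_(ver (unitv R j)) (fun q : W => f q ^+ 2))) (derive_derive_sqr _ _ open_slit finsler_smooth)// -vgradE.
    by rewrite -mulrA; congr (2 * _); rewrite mulrDl -[in RHS]mulrA [in RHS](mulrC (y 0 l)) !mulrA.
  by apply/funext => x'; rewrite -(derive_ver (fun q : W => f q ^+ 2)).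
rewrite -mulr_sumr big_split/= -mulr_suml -mulr_sumr.
rewrite (derive_hor_sum _ finsler_smooth)// (derive_hor_sum _ (smooth_derive _ finsler_smooth))//.
set a := 'D_ _ f _; set b := 'D_ _ _ _; set c := 'D_ _ _ _.
by move=> E; lra.
Qed.

Lemma fundamental_tensor_dilation x y (a : R) : Omega x -> y != 0 -> 0 < a ->
  fundamental_tensor F x (a *: y) = fundamental_tensor F x y.
Proof.
move=> Ox y0 a0; have an0 : a != 0 by rewrite gt_eqF.
have ay0 : a *: y != 0 by rewrite scaler_eq0 negb_or an0.
have Eg : vgrad x (a *: y) = vgrad x y.
  by apply/rowP => j; rewrite !vgradE derive_ver_dilation.
have Eh : a *: vhess x (a *: y) = vhess x y.
  apply/matrixP => i j; rewrite mxE !vhessE.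
  rewrite (derive_ver_homog (c := 1) _ (smooth_derive _ finsler_smooth))//.
    by rewrite div1r mulVKf.
  by move=> z z0; rewrite mul1r derive_ver_dilation.
have FE := finsler_homog y Ox a0.
rewrite (fundamental_tensorE Ox y0); have := fundamental_tensorE Ox ay0.
move: (fundamental_tensor F x (a *: y)) => g -> {g}.
by rewrite Eg FE [a * _]mulrC -scalerA Eh.
Qed.

Lemma hor_line x y u (h : R) : (x, y) + h *: hor u = (x + h *: u, y).
Proof. by congr (_, _); rewrite /= ?scaler0 ?addr0. Qed.

(** Contraction of [geodesic_coef_collinear] with [y]: by homogeneity of [F] the
    bracket contributes nothing. *)
Lemma projective_factor x y (P : R) : Omega x -> y != 0 ->
  geodesic_coef F x y = P *: y -> 'D_(hor y) f (x, y) = 2 * P * F x y.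
Proof.
move=> Ox y0 GP; have Fn0 : F x y != 0 by rewrite gt_eqF// finsler_pos.
have pE : \sum_j vgrad x y 0 j * y 0 j = F x y.
  have := congr1 (fun M : 'M[R]_1 => M 0 0) (vgrad_euler Ox y0).
  by rewrite !mxE eqxx mulr1n => <-; apply: eq_bigr => j _; rewrite !mxE.
have dE : \sum_j 'D_(hor y) ('D_(ver (unitv R j)) f) (x, y) * y 0 j = 'D_(hor y) f (x, y).
  under eq_bigr do rewrite (derive_comm _ _ open_slit finsler_smooth)//.
  rewrite (derive_ver_sum _ (smooth_derive _ finsler_smooth))//.
  rewrite (derive_comm _ _ open_slit finsler_smooth)//.
  apply: near_line_eq_derive.
  apply: filterS (near_line y oOmega Ox) => h Oh.
  by rewrite hor_line euler_identity.
have E : \sum_j y 0 j * ('D_(hor y) f (x, y) * vgrad x y 0 j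
    + F x y * ('D_(hor y) ('D_(ver (unitv R j)) f) (x, y)
      - 'D_(hor (unitv R j)) f (x, y))) = \sum_j 2 * P * F x y * (vgrad x y 0 j * y 0 j).
  apply: eq_bigr => j _; rewrite (geodesic_coef_collinear j Ox y0 GP).
  by rewrite [LHS]mulrC mulrA.
rewrite -mulr_sumr pE in E.
apply: (mulIf Fn0); rewrite -E.
transitivity ('D_(hor y) f (x, y) * \sum_j vgrad x y 0 j * y 0 j
   + F x y * (\sum_j 'D_(hor y) ('D_(ver (unitv R j)) f) (x, y) * y 0 j
     - \sum_j 'D_(hor (unitv R j)) f (x, y) * y 0 j)).
  by rewrite dE pE (derive_hor_sum _ finsler_smooth)// subrr mulr0 addr0.
exact/esym/sum_collinear.
Qed.

(** Hamel's equation: once the projective factor is known, the component of the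
    spray equation along [vgrad] cancels and only this remains. *)
Lemma hamel x y (P : R) j : Omega x -> y != 0 -> geodesic_coef F x y = P *: y ->
  'D_(hor y) ('D_(ver (unitv R j)) f) (x, y) = 'D_(hor (unitv R j)) f (x, y).
Proof.
move=> Ox y0 GP; have Fn0 : F x y != 0 by rewrite gt_eqF// finsler_pos.
have := geodesic_coef_collinear j Ox y0 GP.
rewrite (projective_factor Ox y0 GP) => /eqP.
rewrite -subr_eq0 addrAC subrr add0r mulf_eq0 (negbTE Fn0)/= subr_eq0.
by move/eqP.
Qed.

Hypothesis collinear_spray : forall x y, Omega x -> y != 0 ->
  exists P, geodesic_coef F x y = P *: y.

(** Hamel's equation holds for every velocity [z]; both sides are differentiated at
    [z = y], the left-hand one depending on [z] also through the direction [hor z]. *)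
Lemma hamel_derive x y i j : Omega x -> y != 0 ->
  'D_(hor y) ('D_(ver (unitv R i)) ('D_(ver (unitv R j)) f)) (x, y)
  = 'D_(hor (unitv R j)) ('D_(ver (unitv R i)) f) (x, y)
    - 'D_(hor (unitv R i)) ('D_(ver (unitv R j)) f) (x, y).
Proof.
move=> Ox y0; set u := ver (unitv R j); set v := ver (unitv R i).
have sH : smooth_on U ('D_u f) := smooth_derive u finsler_smooth.
have Uxy : U (x, y) by [].
have dd w : is_derive (0 : R) (1 : R) (fun h : R => 'D_w ('D_u f) ((x, y) + h *: v))
    ('D_v ('D_w ('D_u f)) (x, y)).
  have := @is_derive_line _ _ ('D_w ('D_u f)) (x, y) v 0.
  rewrite scale0r addr0; apply.
  exact: (smooth_derivable (smooth_derive w sH)).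
pose d0 := 'D_v ('D_(hor y) ('D_u f)) (x, y) + 'D_(hor (unitv R i)) ('D_u f) (x, y).
have Dlin : is_derive (0 : R) (1 : R) (fun h : R =>
     'D_(hor y) ('D_u f) ((x, y) + h *: v)
     + h * 'D_(hor (unitv R i)) ('D_u f) ((x, y) + h *: v)) d0.
  have H1 := is_deriveM (is_derive_id (0 : R) (1 : R)) (dd (hor (unitv R i))).
  have H2 := is_deriveD (dd (hor y)) H1.
  apply: (is_derive_eq H2); rewrite /d0; congr (_ + _).
  by rewrite !scale0r add0r addr0; exact: mulr1.
have Dh : is_derive (0 : R) (1 : R) (fun h : R =>
    'D_(hor (unitv R j)) f ((x, y) + h *: v)) d0.
  apply: near_eq_is_derive Dlin.
  apply: filterS (near_line v open_slit Uxy) => h Uh.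
  have Uh' := Uh; rewrite ver_line in Uh'; case: Uh' => /= _ yh0.
  have [P GP] := collinear_spray Ox yh0.
  rewrite !ver_line -(hamel j Ox yh0 GP).
  have -> : hor (y + h *: unitv R i) = hor y + h *: hor (unitv R i).
    by congr (_, _); rewrite /= scaler0 addr0.
  have Uxh : U (x, y + h *: unitv R i) by [].
  rewrite (derive_dirD _ _ open_slit sH Uxh).
  by have [_ ->] := is_deriveZ_dir h (smooth_derivable (v := hor (unitv R i)) sH Uxh).
have [_ L] := @is_derive_line0 _ _ ('D_(hor (unitv R j)) f) (x, y) v d0 Dh.
rewrite (derive_comm _ _ open_slit sH)//.
rewrite [X in _ = X - _](derive_comm _ _ open_slit finsler_smooth)//.
exact: add_eq_subr (esym L).
Qed.

(** The left-hand side of [hamel_derive] is symmetric in [i] and [j], its right-hand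
    side antisymmetric. *)
Lemma vhess_parallel x y i j : Omega x -> y != 0 ->
  'D_(hor y) ('D_(ver (unitv R i)) ('D_(ver (unitv R j)) f)) (x, y) = 0.
Proof.
move=> Ox y0.
have sym : 'D_(hor y) ('D_(ver (unitv R i)) ('D_(ver (unitv R j)) f)) (x, y)
    = 'D_(hor y) ('D_(ver (unitv R j)) ('D_(ver (unitv R i)) f)) (x, y).
  apply: near_line_eq_derive.
  apply: filterS (near_line y oOmega Ox) => h Oh.
  by rewrite hor_line; apply: (derive_comm _ _ open_slit finsler_smooth).
exact: (sym_antisym_eq0 sym (hamel_derive i j Ox y0) (hamel_derive j i Ox y0)).
Qed.

Lemma vhess_line_cst x y : Omega x -> y != 0 ->
  \forall s \near (0 : R), Omega (x + s *: y) /\ vhess (x + s *: y) y = vhess x y.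
Proof.
move=> Ox y0; have /nbhs_ballP[d /= d0 dP] := near_line y oOmega Ox.
near=> s; have sd : `|s| < d by near: s; exact: (@nbhs0_lt _ R^o).
have inO (r : R) : `|r| <= `|s| -> Omega (x + r *: y).
  by move=> rs; apply: dP; rewrite -ball_normE /ball_/= sub0r normrN (le_lt_trans rs).
split; first exact: inO.
apply/matrixP => i j; rewrite !vhessE.
have [r rs|c cs] := @MVT0 R (fun r => 'D_(ver (unitv R i)) ('D_(ver (unitv R j)) f)
    ((x, y) + r *: hor y)) (cst 0) s.
  have Or := inO r rs.
  rewrite -(vhess_parallel i j Or y0) -hor_line; apply: is_derive_line.
  apply: (smooth_derivable (smooth_derive _ (smooth_derive _ finsler_smooth))).
  by rewrite hor_line.
by rewrite mul0r !hor_line scale0r addr0 => /eqP; rewrite subr_eq0 => /eqP.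
Unshelve. all: by end_near. Qed.

(** Along a line the metric changes only through [F] and [vgrad]; the kernel
    vector [y] of [vhess] then makes the determinant proportional to a power of [F]. *)
Lemma det_fundamental_tensor_line x y : Omega x -> y != 0 ->
  \forall s \near (0 : R), Omega (x + s *: y) /\
    \det (fundamental_tensor F (x + s *: y) y)
    = (F (x + s *: y) y / F x y) ^+ n.+1 * \det (fundamental_tensor F x y).
Proof.
move=> Ox y0; apply: filterS (vhess_line_cst Ox y0) => s [Os hs]; split=> //.
have Fn0 : F x y != 0 by rewrite gt_eqF// finsler_pos.
have Fsn0 : F (x + s *: y) y != 0 by rewrite gt_eqF// finsler_pos.
(* Any covector of value 1 on y serves as reference. *)
pose q := (F x y)^-1 *: vgrad x y.
have qy : q *m y^T = 1%:M.
  by rewrite -scalemxAl vgrad_euler// scale_scalar_mx mulVf.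
have detE z : Omega z -> vhess z y = vhess x y -> \det (fundamental_tensor F z y)
    = F z y ^+ n.+1 * \det (vhess x y + q^T *m q).
  move=> Oz hz; rewrite fundamental_tensorE// hz; apply: det_scale_rank1 qy.
  - by rewrite gt_eqF// finsler_pos.
  - by rewrite vhess_eulerT.
  - by rewrite vhess_euler.
  - by rewrite vgrad_euler.
exact: eq_ratio_exp Fn0 (detE _ Os hs) (detE _ Ox erefl).
Qed.

End FinslerMetrics.

(** * Curves on lines *)

Section CurvesOnLines.
Context {R : realType} {n : nat}.
Implicit Types (t : R) (J : interval R) (c w : R -> 'rV[R]_n) (d u x y : 'rV[R]_n).

Lemma has_deriv_is_derive J c t u : open [set` J] -> t \in J ->
  has_deriv_in J c t u -> is_derive t 1 c u.
Proof.
move=> oJ tJ cu.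
have H : (fun h : R => h^-1 *: (c (h *: (1 : R) + t) - c t)) @ 0^' --> u.
  apply/cvgrPdist_lt => e e0.
  have /cvgrPdist_lt/(_ _ e0) := cu.
  rewrite /within/= => /nbhs_ballP[r /= r0 rP].
  have /nbhs_ballP[r' /= r'0 r'P] : nbhs t [set` J] by exact: open_nbhs_nbhs.
  near=> h; have h0 : h != 0 by near: h; exact: nbhs_dnbhs_neq.
  have hr : `|h| < r by near: h; exact: (@dnbhs0_lt _ R^o).
  have hr' : `|h| < r' by near: h; exact: (@dnbhs0_lt _ R^o).
  have E : h *: (1 : R) + t - t = h by rewrite addrK; exact: mulr1.
  have := rP (h *: (1 : R) + t); rewrite E; apply.
  - by rewrite -ball_normE /ball_/= -opprB E normrN.
  - by apply: contra_neq h0 => ht; rewrite -E ht subrr.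
  - by apply: r'P; rewrite -ball_normE /ball_/= -opprB E normrN.
apply: DeriveDef; first by apply/cvg_ex; exists u.
exact: cvg_lim H.
Unshelve. all: by end_near. Qed.

Lemma is_derive_coord c t u i : is_derive t 1 c u ->
  is_derive t 1 (fun s => c s 0 i) (u 0 i).
Proof.
move=> [dc <-]; apply: DeriveDef; first by move/derivable_mxP: dc; exact.
by rewrite derive_mx// mxE.
Qed.

(** In coordinates, a curve on a line is a fixed multiple of one of its
    coordinates, and this proportionality passes to the derivative. *)
Lemma collinear_derive J c t b d u : open [set` J] -> t \in J -> d != 0 ->
  (forall s, s \in J -> exists k, c s = b + k *: d) ->
  is_derive t 1 c u -> exists k, u = k *: d.
Proof.
move=> oJ tJ /rV0Pn[i di] cE dc; exists (u 0 i / d 0 i); apply/rowP => j.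
have dci := is_derive_coord i dc; have dcj := is_derive_coord j dc.
have D : is_derive t 1 (fun s => (c s 0 i - b 0 i) * (d 0 j / d 0 i) + b 0 j)
    (u 0 i * (d 0 j / d 0 i)).
  apply: is_derive_eq; rewrite !scaler0 add0r addr0 subr0; exact: mulrC.
have D' : is_derive t 1 (fun s => c s 0 j) (u 0 i * (d 0 j / d 0 i)).
  apply: near_eq_is_derive D.
  have : nbhs t [set` J] by exact: open_nbhs_nbhs.
  apply: filterS => s /= sJ; have [k ->] := cE s sJ.
  by rewrite !mxE; field.
by rewrite mxE -mulrA [_^-1 * _]mulrC; case: dcj => _ <-; case: D' => _ <-.
Qed.

End CurvesOnLines.

Lemma scaler_line_inj {K : fieldType} {V : lmodType K} (y : V) : y != 0 ->
  injective (fun a : K => a *: y).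
Proof.
move=> y0 a b /eqP; rewrite -subr_eq0 -scalerBl scaler_eq0 (negbTE y0) orbF.
by rewrite subr_eq0 => /eqP.
Qed.

Section OnAnInterval.
Context {R : realType}.
Implicit Types (J : interval R) (g dg : R -> R) (s t : R).

Lemma itv_segment J s t r : s \in J -> t \in J -> s <= r <= t -> r \in J.
Proof. by move=> sJ tJ str; exact: (@interval_is_interval _ J s t). Qed.

Lemma is_derive0_cst J g : (forall t, t \in J -> is_derive t 1 g 0) ->
  forall s t, s \in J -> t \in J -> g s = g t.
Proof.
move=> dg s t; wlog st : s t / s < t => [H sJ tJ|sJ tJ].
  by have [st|ts|->//] := ltgtP s t; [exact: H|exact/esym/H].
have [r srt|r _] := @MVT_is_derive R g (cst 0) s t st.
  by apply: dg; exact: itv_segment srt.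
by rewrite mul0r => /eqP; rewrite subr_eq0 => /eqP.
Qed.

(** Intermediate value theorem. *)
Lemma nonzero_same_sign J g dg t0 : (forall t, t \in J -> is_derive t 1 g (dg t)) ->
  (forall t, t \in J -> g t != 0) -> t0 \in J -> 0 < g t0 ->
  forall t, t \in J -> 0 < g t.
Proof.
move=> dgP g0 t0J gt0 t tJ; rewrite lt_neqAle eq_sym g0//= leNgt; apply/negP => gt.
have cg (p q : R) : p \in J -> q \in J -> {within `[p, q], continuous g}.
  move=> pJ qJ; apply: derivable_within_continuous => r; rewrite in_itv/= => pq.
  by have [] := dgP r (itv_segment pJ qJ pq).
have no (p q : R) : p \in J -> q \in J -> p <= q -> (g p < 0 < g q) || (g q < 0 < g p) -> False.
  move=> pJ qJ pq sg; have [|r] := @IVT R g p q 0 pq (cg p q pJ qJ).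
    rewrite ge_min le_max; case/orP: sg => /andP[/ltW -> /ltW ->]; by rewrite ?orbT.
  rewrite in_itv/= => prq gr0; have := g0 r (itv_segment pJ qJ prq).
  by rewrite gr0 eqxx.
case: (leP t0 t) => [tt|/ltW tt]; first by apply: (no t0 t) => //; rewrite gt gt0 orbT.
by apply: (no t t0) => //; rewrite gt gt0.
Qed.

Lemma near_eq_derive1 (g1 g2 : R -> R) t :
  (\forall s \near t, g1 s = g2 s) -> derive1 g1 t = derive1 g2 t.
Proof. by move=> g12; rewrite !derive1E; exact: near_eq_derive. Qed.

End OnAnInterval.

(** * Geodesics and S-curvature of projectively flat metrics *)

Section Geodesics.
Context {R : realType} {n : nat}.
Variables (Omega : set 'rV[R]_n) (F : 'rV[R]_n -> 'rV[R]_n -> R).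
Hypotheses (oOmega : open Omega) (hF : finsler_metric Omega F).
Hypothesis hflat : projectively_flat Omega F.
Implicit Types (x y : 'rV[R]_n) (J : interval R) (c v : R -> 'rV[R]_n) (t : R).

Local Notation W := ('rV[R]_n * 'rV[R]_n)%type.
Local Notation f := (fun p : W => F p.1 p.2).
Local Notation U := [set p : W | Omega p.1 /\ p.2 != 0].
Local Notation hor u := ((u, 0) : W).

Definition geodesic_velocity J c v := forall t, t \in J ->
    [/\ Omega (c t), v t != 0, has_deriv_in J c t (v t)
      & has_deriv_in J v t (- (2 *: geodesic_coef F (c t) (v t)))].

(** The affine coordinate along [y] is read off from one coordinate in which [y]
    does not vanish. *)
Lemma geodesic_line_param J c v t0 y (m : R) : open [set` J] -> t0 \in J ->
  geodesic_velocity J c v -> v t0 = m *: y ->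
  exists a a1 a2 : R -> R, forall t, t \in J ->
   [/\ c t = c t0 + a t *: y, v t = a1 t *: y,
       geodesic_coef F (c t) (v t) = - (a2 t / 2) *: y,
       is_derive t 1 a (a1 t) & is_derive t 1 a1 (a2 t)].
Proof.
move=> oJ t0J gc vt0.
have gJ : geodesic Omega F J c by exists v.
have [L [p [d [d0 LE]]] cL] := hflat gJ; rewrite {}LE in cL.
have cE s : s \in J -> exists k, c s = p + k *: d.
  by move=> sJ; have [|k _ <-] := cL (c s); [exists s|exists k].
have dc t : t \in J -> is_derive t 1 c (v t).
  by move=> tJ; have [_ _ cv _] := gc t tJ; exact: has_deriv_is_derive cv.
have vE s : s \in J -> exists k, v s = k *: d.
  by move=> sJ; exact: (collinear_derive oJ sJ d0 cE (dc s sJ)).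
have vn0 : v t0 != 0 by have [] := gc t0 t0J.
have [k0 k0E] := vE t0 t0J.
have k0n0 : k0 != 0 by apply: contra_neq vn0 => k00; rewrite k0E k00 scale0r.
have dE : d = (m / k0) *: y.
  by rewrite mulrC -scalerA -vt0 k0E scalerA mulVf// scale1r.
have y0 : y != 0 by apply: contra_neq vn0 => y00; rewrite vt0 y00 scaler0.
have cE' s : s \in J -> exists k, c s = c t0 + k *: y.
  move=> sJ; have [k1 ->] := cE s sJ; have [k2 ->] := cE t0 t0J.
  exists ((k1 - k2) * (m / k0)); rewrite -scalerA -dE scalerBl.
  by rewrite -[RHS]addrA [k2 *: d + _]addrC subrK.
have vE' s : s \in J -> exists k, v s = 0 + k *: y.
  move=> sJ; have [k ->] := vE s sJ; exists (k * (m / k0)).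
  by rewrite add0r -scalerA -dE.
have dv t : t \in J -> is_derive t 1 v (- (2 *: geodesic_coef F (c t) (v t))).
  by move=> tJ; have [_ _ _ vv] := gc t tJ; exact: has_deriv_is_derive vv.
have [i yi] := rV0Pn _ y0.
exists (fun t => (c t 0 i - c t0 0 i) / y 0 i), (fun t => v t 0 i / y 0 i),
  (fun t => (- (2 *: geodesic_coef F (c t) (v t))) 0 i / y 0 i) => t tJ.
have [k kE] := collinear_derive oJ tJ y0 vE' (dv t tJ).
split.
- have [k' k'E] := cE' t tJ.
  by rewrite [in RHS]k'E !mxE addrAC subrr add0r mulfK.
- by have [k' k'E] := vE' t tJ; rewrite [in RHS]k'E !mxE add0r mulfK// -[k' *: y]add0r.
- rewrite kE mxE mulfK// [k / 2]mulrC scaleNr -scalerA -kE.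
  by rewrite scalerN opprK scalerA mulVf ?pnatr_eq0// scale1r.
- have dci := is_derive_coord i (dc t tJ).
  apply: is_derive_eq; rewrite !scaler0 add0r subr0; exact: mulrC.
- have dvi := is_derive_coord i (dv t tJ).
  apply: is_derive_eq; rewrite !scaler0 add0r; exact: mulrC.
Qed.

Lemma sub_geodesic J J' c v : {subset J' <= J} ->
  geodesic_velocity J c v -> geodesic_velocity J' c v.
Proof.
have sub (w : R -> 'rV[R]_n) t u : {subset J' <= J} -> has_deriv_in J w t u -> has_deriv_in J' w t u.
  by move=> J'J; apply: cvg_trans; apply: cvg_app; apply: within_subset.
move=> J'J gc t tJ'; have [Oc v0 cv vv] := gc t (J'J t tJ').
by split => //; exact: sub.
Qed.

Lemma metric_line_is_derive x y (s : R) : y != 0 -> Omega (x + s *: y) ->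
  is_derive s 1 (fun s => F (x + s *: y) y) ('D_(hor y) f (x + s *: y, y)).
Proof.
move=> y0 Os; have Us : U (x + s *: y, y) by [].
have := @is_derive_line _ _ f (x, y) (hor y) s.
rewrite hor_line => H; have {}H := H (smooth_derivable (finsler_smooth hF) Us).
apply: near_eq_is_derive H; near=> r.
by rewrite hor_line.
Unshelve. all: by end_near. Qed.

Lemma derive_hor_dilation x y (a : R) : Omega x -> y != 0 -> 0 < a ->
  'D_(hor (a *: y)) f (x, a *: y) = a ^+ 2 * 'D_(hor y) f (x, y).
Proof.
move=> Ox y0 a0; have an0 : a != 0 by rewrite gt_eqF.
have ay0 : a *: y != 0 by rewrite scaler_eq0 negb_or an0.
have Ua : U (x, a *: y) by [].
have -> : hor (a *: y) = a *: hor y by congr (_, _); rewrite /= scaler0.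
have [_ ->] := is_deriveZ_dir a
  (smooth_derivable (v := hor y) (finsler_smooth hF) Ua).
rewrite expr2 -mulrA; congr (_ * _).
have D := @metric_line_is_derive x y 0 y0.
rewrite scale0r addr0 in D; have {}D := is_deriveZ a (D Ox).
suff [_ ->] : is_derive (x, a *: y) (hor y) f (a *: 'D_(hor y) f (x, y)) by [].
apply: (@is_derive_line0 _ _ f (x, a *: y) (hor y)).
apply: near_eq_is_derive D.
apply: filterS (near_line y oOmega Ox) => h Oh.
by rewrite hor_line (finsler_homog hF).
Qed.

(** Without a geodesic the curve in the definition of S-curvature is constant, and
    so is the distortion along it, contrary to the positive lower bound. *)
Lemma geodesic_from_in (b : R) x y : 0 < b -> S_curvature_ge Omega F b ->
  Omega x -> y != 0 -> geodesics_from Omega F x y (geodesic_from Omega F x y).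
Proof.
move=> b0 hS Ox y0; apply: contrapT => noc.
have := hS x y Ox y0.
have -> : S_curvature Omega F x y = 0.
  rewrite /S_curvature /geodesic_from xgetPN; last first.
    move=> c cP; apply: noc; exact: xgetI cP.
  rewrite (_ : (fun t : R => _) = cst (distortion F x 0)); first exact: derive1_cst.
  by apply/funext => t; rewrite (derive1_cst x t).
by apply/negP; rewrite -ltNge mulr_gt0// (finsler_pos hF).
Qed.

Lemma geodesics_from_velocity x y c : geodesics_from Omega F x y c ->
  exists2 e : R, 0 < e & exists v, [/\ geodesic_velocity `]- e, e[ c v, c 0 = x & v 0 = y].
Proof.
move=> [[e e0 [v gc]] c0 c'0]; exists e => //; exists v; split => //.
have J0 : (0 : R) \in `]- e, e[ by rewrite in_itv/= oppr_lt0 e0.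
have [_ _ cv _] := gc 0 J0.
have [_ <-] := has_deriv_is_derive (@itv_open _ _ (- e) e) J0 cv.
by rewrite -derive1E.
Qed.

Variable b : R.
Hypotheses (b0 : 0 < b) (hS : S_curvature_ge Omega F b).

(** The geodesic with initial velocity [y] runs on a line, so its acceleration, which
    is [- 2 G], is a multiple of [y]. *)
Lemma collinear_spray x y : Omega x -> y != 0 ->
  exists P, geodesic_coef F x y = P *: y.
Proof.
move=> Ox y0; have [e e0 [v [gc c0 v0]]] :=
  geodesics_from_velocity (geodesic_from_in b0 hS Ox y0).
have J0 : (0 : R) \in `]- e, e[ by rewrite in_itv/= oppr_lt0 e0.
have v01 : v 0 = 1 *: y by rewrite scale1r.
have [a [a1 [a2 /(_ 0 J0)[_ _]]]] :=
  geodesic_line_param (@itv_open _ _ (- e) e) J0 gc v01.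
by rewrite c0 v0 => -> _ _; exists (- (a2 0 / 2)).
Qed.

Lemma distortion_dilation x y (a : R) : Omega x -> y != 0 -> 0 < a ->
  distortion F x (a *: y) = distortion F x y.
Proof.
by move=> Ox y0 a0; rewrite /distortion (fundamental_tensor_dilation oOmega hF).
Qed.

(** By [det_fundamental_tensor_line], the distortion is [(n + 1) / 2 * ln F] up to a
    constant. *)
Lemma distortion_line_derive x y : Omega x -> y != 0 ->
  0 < \det (fundamental_tensor F x y) ->
  is_derive (0 : R) (1 : R) (fun s : R => distortion F (x + s *: y) y)
    (n.+1%:R / 2 * ('D_(hor y) f (x, y) / F x y)).
Proof.
move=> Ox y0 d0; have F0 := finsler_pos hF Ox y0.
set D := \det _ in d0; set f0 := F x y in F0 *.
have Ox0 : Omega (x + (0 : R) *: y) by rewrite scale0r addr0.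
have dF := metric_line_is_derive y0 Ox0; rewrite scale0r addr0 in dF.
have Fx0 : F (x + (0 : R) *: y) y = f0 by rewrite scale0r addr0.
have dln : is_derive (F (x + (0 : R) *: y) y) 1 (@ln R) f0^-1.
  by rewrite Fx0; exact: is_derive1_ln.
have dl := @is_derive1_comp _ (@ln R) (fun s : R => F (x + s *: y) y) 0 _ _ dln dF.
have dtau : is_derive (0 : R) (1 : R) (fun s : R => n.+1%:R / 2 * ln (F (x + s *: y) y)
     + (ln D / 2 - n.+1%:R / 2 * ln f0)) (n.+1%:R / 2 * ('D_(hor y) f (x, y) / f0)).
  have H1 := is_deriveZ (n.+1%:R / 2) dl.
  have H2 := is_deriveD H1 (is_derive_cst (ln D / 2 - n.+1%:R / 2 * ln f0) (0 : R) (1 : R)).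
  apply: (is_derive_eq H2); rewrite addr0 [f0^-1 * _]mulrC; reflexivity.
apply: near_eq_is_derive dtau.
apply: filterS (det_fundamental_tensor_line oOmega hF collinear_spray Ox y0) => s [Os dE].
have Fs0 := finsler_pos hF Os y0.
rewrite /distortion dE -/D -/f0.
have r0 : 0 < F (x + s *: y) y / f0 by rewrite divr_gt0.
have p0 : 0 < (F (x + s *: y) y / f0) ^+ n.+1 * D by rewrite mulr_gt0// exprn_gt0.
have -> : ln (Num.sqrt ((F (x + s *: y) y / f0) ^+ n.+1 * D))
    = ln ((F (x + s *: y) y / f0) ^+ n.+1 * D) / 2.
  rewrite -[in RHS](sqr_sqrtr (ltW p0)) lnXn ?sqrtr_gt0//.
  by rewrite mulr2n mulrDl -splitr.
rewrite lnM ?posrE ?exprn_gt0// lnXn// ln_div ?posrE// -[_ *+ n.+1]mulr_natr.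
by field.
Qed.

(** With a nonpositive determinant the square root, hence the distortion, vanishes
    along the line; this degenerate case is then refuted by the curvature bound. *)
Lemma distortion_line_derive0 x y : Omega x -> y != 0 ->
  \det (fundamental_tensor F x y) <= 0 ->
  is_derive (0 : R) (1 : R) (fun s : R => distortion F (x + s *: y) y) 0.
Proof.
move=> Ox y0 d0.
apply: near_eq_is_derive (is_derive_cst (ln (0 : R)) (0 : R) (1 : R)).
apply: filterS (det_fundamental_tensor_line oOmega hF collinear_spray Ox y0) => s [Os dE].
rewrite /distortion dE ler0_sqrtr// mulr_ge0_le0// exprn_ge0// divr_ge0//.
  by rewrite ltW// (finsler_pos hF).
by rewrite ltW// (finsler_pos hF).
Qed.

(** For [t] near 0 the velocity is a positive multiple of [y], and the distortion does
    not depend on that multiple; so only the derivative along the line remains. *)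
Lemma S_curvature_line x y : Omega x -> y != 0 ->
  S_curvature Omega F x y = n.+1%:R / 2 * ('D_(hor y) f (x, y) / F x y).
Proof.
move=> Ox y0; have F0 := finsler_pos hF Ox y0.
have [e e0 [v [gc c0 v0]]] :=
  geodesics_from_velocity (geodesic_from_in b0 hS Ox y0).
set c := geodesic_from Omega F x y in gc c0.
have J0 : (0 : R) \in `]- e, e[ by rewrite in_itv/= oppr_lt0 e0.
have v01 : v 0 = 1 *: y by rewrite scale1r.
have oJ := @itv_open _ R (- e) e.
have [a [a1 [a2 aP]]] := geodesic_line_param oJ J0 gc v01.
have [c00 v00 _ da0 da10] := aP 0 J0.
have a00 : a 0 = 0.
  move: c00; rewrite -[LHS]addr0 => /addrI/esym/eqP.
  by rewrite scaler_eq0 (negbTE y0) orbF => /eqP.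
have a10 : a1 0 = 1.
  by move: v00; rewrite v01 => /(scaler_line_inj y0).
have near_tau : \forall t \near (0 : R),
    distortion F (c t) (derive1 c t) = distortion F (x + a t *: y) y.
  have a1pos : \forall t \near (0 : R), 0 < a1 t.
    have ca1 : a1 @ (0 : R) --> a1 0.
      by apply: differentiable_continuous; apply/derivable1_diffP; case: da10.
    have /cvgrPdist_lt/(_ 1 ltr01) := ca1.
    apply: filterS => t; rewrite a10 ltr_norml => /andP[_].
    by rewrite ltrBlDr ltrDl.
  have nJ : nbhs (0 : R) [set` `]- e, e[] by exact: open_nbhs_nbhs.
  apply: filterS2 a1pos nJ => t a1t tJ.
  have [_ _ cv _] := gc t tJ; have [cE vE _ _ _] := aP t tJ.
  have [Oct _ _ _] := gc t tJ.
  have [_ dct] := has_deriv_is_derive oJ tJ cv.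
  rewrite c0 in cE; rewrite cE in Oct.
  rewrite derive1E dct vE cE; exact: distortion_dilation.
have Sa : S_curvature Omega F x y
    = derive1 (fun t => distortion F (x + a t *: y) y) 0.
  change (derive1 (fun t => distortion F (c t) (derive1 c t)) 0
    = derive1 (fun t => distortion F (x + a t *: y) y) 0).
  exact: near_eq_derive1 near_tau.
have [dpos|dneg] := ltP 0 (\det (fundamental_tensor F x y)).
  have dt := distortion_line_derive Ox y0 dpos.
  rewrite -{1}a00 in dt.
  have [_ dE] := @is_derive1_comp _ (fun s : R => distortion F (x + s *: y) y) a 0 _ _ dt da0.
  by rewrite Sa (etrans (derive1E _ _) dE) a10 mulr1.
have S0 : S_curvature Omega F x y = 0.
  have dt := distortion_line_derive0 Ox y0 dneg.
  rewrite -{1}a00 in dt.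
  have [_ dE] := @is_derive1_comp _ (fun s : R => distortion F (x + s *: y) y) a 0 _ _ dt da0.
  by rewrite Sa (etrans (derive1E _ _) dE) mul0r.
by have := hS Ox y0; rewrite S0 leNgt mulr_gt0.
Qed.

(** Solving [S_curvature_line] for the derivative of [F] along the line turns the
    curvature bound into the Riccati inequality. *)
Lemma derive_hor_ge x y : Omega x -> y != 0 ->
  2 * b / n.+1%:R * F x y ^+ 2 <= 'D_(hor y) f (x, y).
Proof.
move=> Ox y0; have F0 := finsler_pos hF Ox y0.
have := hS Ox y0; rewrite S_curvature_line// mulrA ler_pdivlMr// => H.
move: H; have N0 : 0 < n.+1%:R :> R by rewrite ltr0n.
move: (n.+1%:R : R) N0 => N N0 H.
have n0 : 0 < N / 2 by rewrite divr_gt0.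
rewrite -(ler_pM2l n0); apply: le_trans H.
by rewrite le_eqVlt; apply/orP; left; apply/eqP; field; rewrite gt_eqF.
Qed.

(** Conservation of the speed [F (c t) (c' t)], which is [K], for the affine
    coordinate [a] of the geodesic. *)
Lemma geodesic_clairaut J c v t0 y (m : R) : open [set` J] -> t0 \in J ->
  geodesic_velocity J c v -> 0 < m -> v t0 = m *: y ->
  exists a a1 : R -> R, exists2 K : R, 0 < K & a t0 = 0 /\
    forall t, t \in J -> [/\ Omega (c t0 + a t *: y), is_derive t 1 a (a1 t),
      0 < a1 t & a1 t * F (c t0 + a t *: y) y = K].
Proof.
move=> oJ t0J gc m0 vt0.
have [a [a1 [a2 aP]]] := geodesic_line_param oJ t0J gc vt0.
have vn0 t : t \in J -> v t != 0 by move=> tJ; have [] := gc t tJ.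
have y0 : y != 0 by apply: contra_neq (vn0 t0 t0J) => y00; rewrite vt0 y00 scaler0.
have Oa t : t \in J -> Omega (c t0 + a t *: y).
  by move=> tJ; have [Oc _ _ _] := gc t tJ; have [<- _ _ _ _] := aP t tJ.
have da t : t \in J -> is_derive t 1 a (a1 t) by move=> tJ; have [] := aP t tJ.
have da1 t : t \in J -> is_derive t 1 a1 (a2 t) by move=> tJ; have [] := aP t tJ.
have a1n0 t : t \in J -> a1 t != 0.
  move=> tJ; apply: contra_neq (vn0 t tJ) => a10.
  by have [_ -> _ _ _] := aP t tJ; rewrite a10 scale0r.
have a1t0 : 0 < a1 t0.
  have [_ vE _ _ _] := aP t0 t0J; move: vE; rewrite vt0 => /(scaler_line_inj y0) <-.
  exact: m0.
have a1pos := nonzero_same_sign da1 a1n0 t0J a1t0.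
have at0 : a t0 = 0.
  have [cE _ _ _ _] := aP t0 t0J; move: cE; rewrite -[LHS]addr0 => /addrI/esym/eqP.
  by rewrite scaler_eq0 (negbTE y0) orbF => /eqP.
pose g t := a1 t * F (c t0 + a t *: y) y.
have dg t : t \in J -> is_derive t 1 g 0.
  move=> tJ; have [cE vE GE _ _] := aP t tJ; have Ot := Oa t tJ.
  have a1p := a1pos t tJ.
  have v0 := vn0 t tJ; rewrite vE in v0.
  rewrite cE vE in GE.
  have GE' : geodesic_coef F (c t0 + a t *: y) (a1 t *: y)
      = (- (a2 t / 2) / a1 t) *: (a1 t *: y).
    by rewrite GE scalerA divfK// gt_eqF.
  have P := projective_factor oOmega hF Ot v0 GE'.
  rewrite derive_hor_dilation// (finsler_homog hF)// in P.
  have dF := @is_derive1_comp _ (fun s : R => F (c t0 + s *: y) y) a t _ _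
    (metric_line_is_derive y0 Ot) (da t tJ).
  have H := is_deriveM (da1 t tJ) dF.
  apply: (is_derive_eq H).
  move: P; set D := 'D_ _ _ _; set Fa := F _ y => P.
  rewrite /= -/Fa.
  have {}P : a1 t ^+ 2 * D = - (a2 t * Fa).
    by rewrite P; field; rewrite gt_eqF.
  rewrite -[a1 t *: _]/(a1 t * _) -[Fa *: _]/(Fa * _) mulrCA -expr2 mulrC P mulrC.
  exact: addNr.
exists a, a1, (g t0); first by rewrite mulr_gt0// (finsler_pos hF)//; exact: Oa.
split => // t tJ; split; [exact: Oa|exact: da|exact: a1pos|].
exact: (is_derive0_cst dg).
Qed.

End Geodesics.

(** * Monotonicity of the metric and complete geodesics *)

Section Completeness.
Context {R : realType} {n : nat}.
Variables (Omega : set 'rV[R]_n) (F : 'rV[R]_n -> 'rV[R]_n -> R).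
Hypotheses (oOmega : open Omega) (hF : finsler_metric Omega F).
Hypothesis hflat : projectively_flat Omega F.
Variable b : R.
Hypotheses (b0 : 0 < b) (hS : S_curvature_ge Omega F b).
Implicit Types (x y z : 'rV[R]_n) (J : interval R) (c v : R -> 'rV[R]_n) (s t : R).

Local Notation W := ('rV[R]_n * 'rV[R]_n)%type.
Local Notation f := (fun p : W => F p.1 p.2).
Local Notation U := [set p : W | Omega p.1 /\ p.2 != 0].
Local Notation hor u := ((u, 0) : W).
Local Notation k := (2 * b / n.+1%:R).

Lemma rate_gt0 : 0 < k. Proof. by rewrite divr_gt0 ?mulr_gt0// ltr0n. Qed.

Lemma metric_line_mono x y s0 s1 : y != 0 -> s0 <= s1 ->
  (forall s, s0 <= s <= s1 -> Omega (x + s *: y)) ->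
  F (x + s0 *: y) y <= F (x + s1 *: y) y.
Proof.
move=> y0; rewrite le_eqVlt => /predU1P[->//|s01] O.
have [s ss|s /andP[s0s ss1]] := @MVT_is_derive R (fun s => F (x + s *: y) y)
  (fun s => 'D_(hor y) f (x + s *: y, y)) s0 s1 s01.
  by apply: (metric_line_is_derive hF y0); exact: O.
move=> E; rewrite -subr_ge0 E mulr_ge0 ?subr_ge0 ?(ltW s01)//.
have Os : Omega (x + s *: y) by apply: O; rewrite !ltW.
apply: le_trans (derive_hor_ge oOmega hF hflat b0 hS Os y0).
by rewrite mulr_ge0 ?sqr_ge0// ltW// rate_gt0.
Qed.

(** The Riccati inequality bounds the derivative of [1 / F] by [- k], while [1 / F]
    is still positive at the end of the segment. *)
Lemma metric_line_bound x y s0 s1 : y != 0 -> s0 < s1 ->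
  (forall s, s0 <= s <= s1 -> Omega (x + s *: y)) ->
  k * (s1 - s0) * F (x + s0 *: y) y <= 1.
Proof.
move=> y0 s01 O.
have Fp s : s0 <= s <= s1 -> 0 < F (x + s *: y) y.
  by move=> ss; apply: (finsler_pos hF) => //; exact: O.
have [s ss|s /andP[s0s ss1]] := @MVT_is_derive R (fun s => (F (x + s *: y) y)^-1)
  (fun s => - (F (x + s *: y) y) ^- 2 *: 'D_(hor y) f (x + s *: y, y)) s0 s1 s01.
  apply: (@is_deriveV _ (fun s => F (x + s *: y) y)); first by rewrite gt_eqF// Fp.
  by apply: (metric_line_is_derive hF y0); exact: O.
have ss : s0 <= s <= s1 by rewrite !ltW.
have := derive_hor_ge oOmega hF hflat b0 hS (O s ss) y0.
have F0p : 0 < F (x + s0 *: y) y by apply: Fp; rewrite lexx ltW.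
have F1p : 0 < F (x + s1 *: y) y by apply: Fp; rewrite lexx ltW.
have Fsp := Fp s ss.
move: rate_gt0; move: (k) ('D_ _ f _) => k' D k0 Dge.
move: (F (x + s0 *: y) y) (F (x + s1 *: y) y) (F (x + s *: y) y) F0p F1p Fsp Dge.
move=> F0 F1 Fs F0p F1p Fsp Dge E.
have {}E : F0^-1 = F1^-1 + D / Fs ^+ 2 * (s1 - s0).
  have -> : F0^-1 = F1^-1 - (F1^-1 - F0^-1) by rewrite opprB addrC subrK.
  by rewrite E -[_ *: D]/(_ * D) mulNr mulNr opprK [_ * D]mulrC.
rewrite -ler_pdivlMr// div1r E.
have kD : k' <= D / Fs ^+ 2 by rewrite ler_pdivlMr// exprn_gt0.
apply: (@le_trans _ _ (D / Fs ^+ 2 * (s1 - s0))).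
  by rewrite ler_pM2r// subr_gt0.
by rewrite lerDr invr_ge0 ltW.
Qed.

Lemma geodesic_coef_dilation x y (a : R) : Omega x -> y != 0 -> 0 < a ->
  geodesic_coef F x (a *: y) = a ^+ 2 *: geodesic_coef F x y.
Proof.
move=> Ox y0 a0; have an0 : a != 0 by rewrite gt_eqF.
have ay0 : a *: y != 0 by rewrite scaler_eq0 negb_or an0.
have [P GP] := collinear_spray hF hflat b0 hS Ox y0.
have [Q GQ] := collinear_spray hF hflat b0 hS Ox ay0.
have EP := projective_factor oOmega hF Ox y0 GP.
have := projective_factor oOmega hF Ox ay0 GQ.
rewrite (derive_hor_dilation oOmega hF Ox y0 a0) (finsler_homog hF _ Ox a0) EP => E.
have Fy := finsler_pos hF Ox y0.
have -> : geodesic_coef F x (a *: y) = Q *: (a *: y) by [].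
rewrite GP !scalerA; congr (_ *: _).
have : (a * (2 * F x y)) * (a * P) = (a * (2 * F x y)) * Q.
  by move: E; clear; move: (F x y) => Fy E; lra.
have c0 : a * (2 * F x y) != 0 by rewrite gt_eqF// mulr_gt0// mulr_gt0.
by move/(mulfI c0) => <-; rewrite expr2 mulrAC.
Qed.

(** The spray is quadratic in the velocity, so geodesics may be rescaled in time;
    this moves a geodesic on a short interval onto the unit interval on which
    completeness is formulated. *)
Lemma geodesic_velocity_affine J J' c v (a d : R) : 0 < a ->
  (forall t, t \in J' -> a * t + d \in J) -> geodesic_velocity Omega F J c v ->
  geodesic_velocity Omega F J' (fun t => c (a * t + d)) (fun t => a *: v (a * t + d)).
Proof.
move=> a0 J'J gc.
have an0 : a != 0 by rewrite gt_eqF.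
have dev (w : R -> 'rV[R]_n) t u : t \in J' -> has_deriv_in J w (a * t + d) u ->
    has_deriv_in J' (fun t => w (a * t + d)) t (a *: u).
  move=> tJ' H.
  have aff : (fun s => a * s + d) @ within [set` J'] t^' --> within [set` J] (a * t + d)^'.
    move=> A; rewrite /= /within/= => /nbhs_ballP[r /= r0 rA].
    apply/nbhs_ballP; exists (r / a) => /=; first exact: divr_gt0.
    move=> s ts st sJ'; apply: rA; last exact: J'J.
      move: ts; rewrite -!ball_normE /ball_/= => ts.
      by rewrite opprD addrACA subrr addr0 -mulrBr normrM gtr0_norm// mulrC -ltr_pdivlMr.
    by apply: contra_neq st => /addIr/(mulfI an0).
  have H2 := cvg_comp _ _ aff H.
  have H3 := cvgZl_tmp (k := a) H2.
  suff E : (fun s => (s - t)^-1 *: (w (a * s + d) - w (a * t + d)))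
      = a \*: ((fun s => (s - (a * t + d))^-1 *: (w s - w (a * t + d)))
          \o (fun s => a * s + d)).
    rewrite /has_deriv_in E; exact: H3.
  apply/funext => s; rewrite /= scalerA; congr (_ *: _).
  by rewrite opprD addrACA subrr addr0 -mulrBr invfM mulrA divff// mul1r.
move=> t tJ'; have [Oc v0 cv vv] := gc _ (J'J t tJ').
split; [exact: Oc|by rewrite scaler_eq0 negb_or an0|exact: dev|].
rewrite (geodesic_coef_dilation Oc v0 a0).
rewrite (_ : - _ = a *: (a *: (- (2 *: geodesic_coef F (c (a * t + d)) (v (a * t + d)))))).
  have H3 := cvgZl_tmp (k := a) (dev _ _ _ tJ' vv).
  suff E : (fun s => (s - t)^-1 *: (a *: v (a * s + d) - a *: v (a * t + d)))
      = a \*: (fun s => (s - t)^-1 *: (v (a * s + d) - v (a * t + d))).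
    rewrite /has_deriv_in E; exact: H3.
  by apply/funext => s; rewrite /= -scalerBr !scalerA mulrC.
by rewrite !scalerN !scalerA expr2; congr (- (_ *: _)); rewrite mulrC.
Qed.

(** The local geodesic with velocity [y] is rescaled by the length of its interval
    of definition and shifted so as to pass through [x] in the middle. *)
Lemma geodesic_through x y : Omega x -> y != 0 ->
  exists2 e : R, 0 < e & exists c v,
    [/\ geodesic_velocity Omega F `[0, 1] c v, c 2^-1 = x & v 2^-1 = e *: y].
Proof.
move=> Ox y0; have [e e0 [v [gc c0 v0]]] :=
  geodesics_from_velocity (geodesic_from_in hF b0 hS Ox y0).
set c := geodesic_from _ _ _ _ in gc c0.
have half : e * 2^-1 + - (e / 2) = 0 by rewrite subrr.
exists e => //; exists (fun t => c (e * t + - (e / 2))), (fun t => e *: v (e * t + - (e / 2))).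
split; [|by rewrite half|by rewrite half v0].
apply: geodesic_velocity_affine gc => // t; rewrite !in_itv/= => /andP[t0 t1].
by apply/andP; split; nra.
Qed.

(** What either notion of completeness yields for a line: the maximal
    geodesic is tracked by its affine coordinate [a] along [y]. *)
Lemma extended_geodesic J (Jo : interval R) c c' v x y (e : R) : y != 0 -> 0 < e ->
  geodesic_velocity Omega F `[0, 1] c v -> c 2^-1 = x -> v 2^-1 = e *: y ->
  geodesic Omega F J c' -> {in `]0, 1[, c' =1 c} ->
  {subset Jo <= J} -> open [set` Jo] -> 2^-1 \in Jo ->
  exists a a1 : R -> R, exists2 K : R, 0 < K & a 2^-1 = 0 /\
    forall t, t \in Jo -> [/\ Omega (x + a t *: y), is_derive t 1 a (a1 t),
      0 < a1 t & a1 t * F (x + a t *: y) y = K].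
Proof.
move=> y0 e0 gc cx vx [v' gc'] c'c JoJ oJo hJo.
have h01 : (2^-1 : R) \in `]0, 1[.
  by rewrite in_itv/= invr_gt0 ltr0n/= invf_lt1// ltr1n.
have c'x : c' 2^-1 = x by rewrite c'c.
have gJo : geodesic_velocity Omega F Jo c' v' by apply: sub_geodesic gc'.
have v'x : v' 2^-1 = e *: y.
  have [_ _ d' _] := gJo _ hJo.
  have [_ <-] := has_deriv_is_derive oJo hJo d'.
  have o01 := @itv_open _ R 0 1.
  have g01 : geodesic_velocity Omega F `]0, 1[ c v.
    apply: sub_geodesic gc => t; rewrite !in_itv/= => /andP[? ?].
    by apply/andP; split; exact: ltW.
  have [_ _ dc _] := g01 _ h01.
  have [_ dcE] := has_deriv_is_derive o01 h01 dc.
  rewrite -vx -dcE; apply: near_eq_derive.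
  have : nbhs (2^-1 : R) [set` `]0, 1[] by exact: open_nbhs_nbhs.
  by apply: filterS => t tJ; exact: c'c.
have := geodesic_clairaut oOmega hF hflat oJo hJo gJo e0 v'x.
by rewrite c'x.
Qed.

Lemma bounded_set_ray x y : bounded_set Omega -> y != 0 ->
  (forall N : R, exists2 s : R, N < `|s| & Omega (x + s *: y)) -> False.
Proof.
move=> /ex_strict_bound_gt0[M _ MO] y0 far.
have yn : 0 < `|y| by rewrite normr_gt0.
have [s sN /MO/= sM] := far ((M + `|x|) / `|y|).
rewrite ltr_pdivrMr// -normrZ in sN.
have := lt_trans sN (_ : `|s *: y| < M + `|x|); rewrite ltxx => H.
suff: false by []; apply: H.
rewrite -ltrBlDr; apply: le_lt_trans sM.
by rewrite [x + _]addrC; exact: lerB_normD.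
Qed.

(** If the points of a ray before the parameter [S] lie in [Omega] and [F] stays
    bounded there, a forward complete geodesic sweeps past [S]: its speed
    [a1 = K / F] is bounded below. *)
Lemma forward_reach (hc : forward_complete Omega F) x y (S M : R) :
  Omega x -> y != 0 -> 0 < S ->
  (forall s, 0 <= s < S -> Omega (x + s *: y) /\ F (x + s *: y) y <= M) ->
  Omega (x + S *: y).
Proof.
move=> Ox y0 S0 O; apply: contrapT => nO.
have [e e0 [c [v [gc cx vx]]]] := geodesic_through Ox y0.
have gc01 : geodesic Omega F `[0, 1[ c.
  exists v; apply: sub_geodesic gc => t; rewrite !in_itv/= => /andP[? ?].
  by apply/andP; split=> //; exact: ltW.
have [c' gc' c'c] := hc c gc01.
have c'c1 : {in `]0, 1[, c' =1 c}.
  by move=> t; rewrite in_itv/= => /andP[t0 t1]; apply: c'c; rewrite in_itv/= t1 ltW.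
have sub : {subset `]0%R, +oo[ <= `[(0 : R), +oo[}.
  by move=> t; rewrite !in_itv/= !andbT => /ltW.
have h0 : (2^-1 : R) \in `]0, +oo[ by rewrite in_itv/= invr_gt0 ltr0n.
have oJ : open [set` `](0 : R), +oo[] by exact: interval_open.
have [a [a1 [K K0 [ah aP]]]] :=
  extended_geodesic y0 e0 gc cx vx gc' c'c1 sub oJ h0.
have inJ t : 2^-1 <= t -> t \in `]0, +oo[.
  by move=> ht; rewrite in_itv/= andbT (lt_le_trans _ ht)// invr_gt0 ltr0n.
have hJ : (2^-1 : R) \in `[2^-1, +oo[ by rewrite in_itv/= lexx.
have J2 t : t \in `[(2^-1 : R), +oo[ -> t \in `]0, +oo[.
  by rewrite in_itv/= andbT; exact: inJ.
have aS t : 2^-1 <= t -> a t < S.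
  move=> ht; rewrite -subr_gt0.
  apply: (@nonzero_same_sign _ `[2^-1, +oo[ (fun t => S - a t) (fun t => - a1 t) 2^-1) => //.
  - move=> r /J2 rJ; have [_ da _ _] := aP r rJ.
    have H := is_deriveB (is_derive_cst S r (1 : R)) da.
    by apply: (is_derive_eq H); exact: sub0r.
  - move=> r /J2 rJ; rewrite subr_eq0; apply/eqP => Sa.
    by apply: nO; have [+ _ _ _] := aP r rJ; rewrite -Sa.
  - by rewrite ah subr0.
  - by rewrite in_itv/= ht.
have M0 : 0 < M.
  have [|Ox0] := O 0; first by rewrite lexx.
  by apply: lt_le_trans; apply: (finsler_pos hF).
(* At speed at least K / M, the distance S is covered by the time T. *)
pose T := 2^-1 + S * M / K.
have T2 : 2^-1 < T by rewrite ltrDl divr_gt0// mulr_gt0.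
have dera p q : 2^-1 <= p -> p < q -> exists2 r, p < r < q & a q - a p = a1 r * (q - p).
  move=> hp pq; apply: MVT_is_derive pq _ => t /andP[pt _].
  by have [] := aP t (inJ t (le_trans hp pt)).
have a_ge0 t : 2^-1 <= t -> 0 <= a t.
  rewrite le_eqVlt => /predU1P[<-|ht]; first by rewrite ah.
  have [r /andP[hr _]] := dera _ _ (lexx _) ht; rewrite ah subr0 => ->.
  have [_ _ a10 _] := aP r (inJ r (ltW hr)).
  by rewrite mulr_ge0// ?subr_ge0 ltW.
have [r /andP[hr _]] := dera _ _ (lexx _) T2; rewrite ah subr0 => aT.
have [Or _ a1r aK] := aP r (inJ r (ltW hr)).
have Fr : F (x + a r *: y) y <= M.
  have arS : 0 <= a r < S by rewrite a_ge0 ?aS ?(ltW hr).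
  by have [_ +] := O _ arS; exact.
have Fr0 : 0 < F (x + a r *: y) y by exact: (finsler_pos hF).
have := aS T (ltW T2); apply/negP; rewrite -leNgt aT /T addrC addKr.
move: (F _ y) (a1 r) aK Fr Fr0 a1r => Fv p aK Fr Fr0 p0.
have Kn0 : K != 0 by rewrite gt_eqF.
rewrite mulrA ler_pdivlMr// mulrCA ler_pM2l// -aK.
by rewrite ler_pM2l.
Qed.

(** Consider the infimum of the parameters whose points lie outside [Omega]. *)
Lemma ray_induction x y (T : R) : Omega x ->
  (forall S : R, 0 < S <= T -> (forall s, 0 <= s < S -> Omega (x + s *: y)) ->
     Omega (x + S *: y)) ->
  forall s, 0 <= s <= T -> Omega (x + s *: y).
Proof.
move=> Ox step s /andP[s0 sT]; apply: contrapT => nOs.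
pose B := [set r : R | 0 <= r <= T /\ ~ Omega (x + r *: y)].
have Bs : B s by split=> //; rewrite s0.
have infB : has_inf B.
  by split; [exists s|exists 0 => r [/andP[]]].
have S0 : 0 <= inf B by apply: lb_le_inf; [exists s|move=> r [/andP[]]].
have SB r : B r -> inf B <= r by move=> Br; apply: ge_inf => //; case: infB.
have ST : inf B <= T by exact: le_trans (SB s Bs) sT.
have OS : Omega (x + inf B *: y).
  move: S0; rewrite le_eqVlt => /predU1P[<-|S0]; first by rewrite scale0r addr0.
  apply: step; first by rewrite S0.
  move=> r /andP[r0 rS]; apply: contrapT => nOr.
  have := SB r; rewrite leNgt rS => H; suff: false by [].
  by apply: H; split=> //; rewrite r0 ltW// (lt_le_trans rS).
have /nbhs_ballP[d /= d0 dP] := near_line y oOmega OS.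
have [r Br rS] := inf_adherent d0 infB.
have [_ nOr] := Br; apply: nOr.
have := dP (r - inf B); rewrite -addrA -scalerDl [inf B + _]addrC subrK; apply.
rewrite -ball_normE /ball_/= sub0r normrN ger0_norm ?subr_ge0 ?SB//.
by rewrite ltrBlDl.
Qed.

(** * Star-shapedness, boundedness and irreversibility *)

Lemma metric_continuous x y : Omega x -> y != 0 -> {for (x, y), continuous f}.
Proof. by move=> Ox y0; apply: (smooth_continuous (finsler_smooth hF)). Qed.

Definition visible x := [set z | forall s : R, 0 <= s <= 1 -> Omega (x + s *: (z - x))].

Lemma visible_sub x : visible x `<=` Omega.
Proof.
by move=> z /(_ 1); rewrite scale1r addrC subrK; apply; rewrite ler01 lexx.
Qed.

(** The unit interval is compact, so a neighbourhood of [z] works for the whole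
    segment at once. *)
Lemma visible_open x : open (visible x).
Proof.
rewrite openE => z vz; rewrite /interior.
have /compact_near_coveringP cpt := @segment_compact R 0 1.
have H : forall s : R, `[0, 1]%classic s ->
    \forall s' \near s & z' \near z, Omega (x + s' *: (z' - x)).
  move=> s /=; rewrite in_itv/= => s01.
  have cg : (fun p : R * 'rV[R]_n => x + p.1 *: (p.2 - x)) @ (s, z) --> x + s *: (z - x).
    apply: cvgD; first exact: cvg_cst.
    apply: cvgZ; first exact: cvg_fst.
    by apply: cvgB; [exact: cvg_snd|exact: cvg_cst].
  by apply: cg; apply: open_nbhs_nbhs; split => //; exact: vz.
have nz : \forall z' \near z, `[0, 1]%classic `<=` (fun s : R => Omega (x + s *: (z' - x))).
  exact: (cpt _ (nbhs z) (fun z' s => Omega (x + s *: (z' - x))) _ H).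
apply: (filterS _ nz) => z' Hz' s s01.
by have := Hz' s; rewrite /= in_itv/=; apply.
Qed.

(** Along a visible segment [F] is largest at the far end, so the bound needed
    by [forward_reach] passes to limits of visible points. *)
Lemma visible_closed (hc : forward_complete Omega F) x : Omega x ->
  Omega `&` closure (visible x) `<=` visible x.
Proof.
move=> Ox z [Oz clz].
have [->|zx] := eqVneq z x.
  by move=> s _; rewrite subrr scaler0 addr0.
have y0 : z - x != 0 by rewrite subr_eq0.
have near_end (w : 'rV[R]_n) (s : R) : w = x + s *: (z - x) -> Omega w ->
    (fun z' => f (x + s *: (z' - x), z' - x)) @ z --> F w (z - x).
  move=> wE Ow.
  have cg : (fun z' => (x + s *: (z' - x), z' - x) : W) @ z --> (w, z - x).
    have c2 : (fun z' => z' - x) @ z --> z - x.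
      exact: (cvgB cvg_id (cvg_cst x)).
    have c1 : (fun z' => x + s *: (z' - x)) @ z --> w.
      rewrite wE; exact: (cvgD (cvg_cst x) (cvgZl_tmp c2)).
    exact: (cvg_pair c1 c2).
  exact: (cvg_comp _ _ cg (metric_continuous Ow y0)).
pose M := F z (z - x) + 1.
have zE : z = x + 1 *: (z - x) by rewrite scale1r addrC subrK.
have nM : \forall z' \near z, F (x + 1 *: (z' - x)) (z' - x) < M.
  have := near_end z 1 zE Oz; move=> /cvgrPdist_lt/(_ 1 ltr01).
  apply: filterS => z' /=; rewrite distrC ltr_norml => /andP[_].
  by rewrite ltrBlDl.
have n0 : \forall z' \near z, z' - x != 0.
  have : nbhs z (~` [set x]).
    apply: open_nbhs_nbhs; split; last by move=> /= zx'; rewrite zx' eqxx in zx.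
    apply: closed_openC; apply: accessible_closed_set1.
    exact: hausdorff_accessible (@norm_hausdorff _ _).
  by apply: filterS => z' /= /eqP; rewrite subr_eq0.
apply: (ray_induction (x := x) (y := z - x) Ox) => S /andP[S0 S1] OS.
apply: (forward_reach hc (M := M) Ox y0 S0) => s sS; split; first exact: OS.
have s1 : s <= 1 by case/andP: sS => _ /ltW /le_trans; apply.
have s0 : 0 <= s by case/andP: sS.
rewrite leNgt; apply/negP => Ms.
have ns : \forall z' \near z, M < F (x + s *: (z' - x)) (z' - x).
  have := near_end _ s erefl (OS s sS).
  have e0 : 0 < F (x + s *: (z - x)) (z - x) - M by rewrite subr_gt0.
  move=> /cvgrPdist_lt/(_ _ e0).
  apply: filterS => z' /=; rewrite ltr_norml => /andP[_].
  by rewrite ltrD2l ltrN2.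
have [z' [vz' [z'0 [z'M Mz']]]] := clz _ (filterI n0 (filterI nM ns)).
have := @metric_line_mono x (z' - x) s 1 z'0 s1 _.
rewrite leNgt (lt_trans z'M Mz') => H; suff : false by [].
apply: H => r /andP[sr r1]; apply: vz'.
by rewrite r1 (le_trans s0 sr).
Qed.

Lemma star_shaped (hc : forward_complete Omega F) x :
  connected Omega -> Omega x -> visible x = Omega.
Proof.
move=> cO Ox; apply: cO.
- exists x => s _; by rewrite subrr scaler0 addr0.
- exists (visible x); first exact: visible_open.
  by apply/seteqP; split => [z vz|z []//]; split => //; exact: visible_sub vz.
- exists (closure (visible x)); first exact: closed_closure.
  apply/seteqP; split=> [z vz|]; last exact: visible_closed.
  by split; [exact: visible_sub vz|exact: subset_closure].
Qed.

(** Compactness of the unit sphere and homogeneity. *)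
Lemma metric_norm_lower x : Omega x ->
  exists2 m : R, 0 < m & forall y, m * `|y| <= F x y.
Proof.
move=> Ox; have F0 : F x 0 = 0.
  by have [_ _ Feq _ _] := hF.2 x Ox; apply/Feq.
pose S := [set y : 'rV[R]_n | `|y| = 1].
have [[u Su]|noS] := pselect (S !=set0); last first.
  exists 1 => // y; have [->|y0] := eqVneq y 0; first by rewrite normr0 mulr0 F0.
  exfalso; apply: noS; exists (`|y|^-1 *: y); rewrite /S/=.
  by rewrite normrZ normfV normr_id mulVf// normr_eq0.
have cS : compact S.
  apply: bounded_closed_compact.
    exists 1; split; first exact: num_real.
    by move=> M M1 y; rewrite /S/= => ->; exact: ltW.
  have -> : S = Num.norm @^-1` [set (1 : R)] by apply/seteqP; split.
  apply: closed_comp; last exact: closed_eq.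
  by move=> y _; exact: norm_continuous.
have Sn0 y : S y -> y != 0 by move=> /= y1; rewrite -normr_eq0 y1 oner_eq0.
have cF : {within S, continuous (F x)}.
  apply: continuous_in_subspaceT => y; rewrite inE => Sy.
  exact: (smooth_continuous (minkowski_smooth (hF.2 x Ox)) (Sn0 y Sy)).
have [w wS wmin] := EVT_min_rV (ex_intro _ u Su) cS cF.
rewrite inE in wS; exists (F x w); first exact: (finsler_pos hF Ox (Sn0 _ wS)).
move=> y; have [->|y0] := eqVneq y 0; first by rewrite normr0 mulr0 F0.
have yn : 0 < `|y| by rewrite normr_gt0.
have Sy : S (`|y|^-1 *: y).
  by rewrite /S/= normrZ normfV normr_id mulVf// normr_eq0.
have := wmin _ (mem_set Sy); rewrite (finsler_homog hF)// ?invr_gt0//.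
by rewrite mulrC ler_pdivlMr.
Qed.

Lemma bounded_domain (hc : forward_complete Omega F) :
  connected Omega -> Omega !=set0 -> bounded_set Omega.
Proof.
move=> cO [x Ox]; have [m m0 mF] := metric_norm_lower Ox.
have k0 := rate_gt0.
suff B z : Omega z -> `|z| <= `|x| + (m * k)^-1.
  exists (`|x| + (m * k)^-1); split; first exact: num_real.
  by move=> M ltM z Oz; exact: le_trans (B z Oz) (ltW ltM).
move=> Oz; have [->|zx] := eqVneq z x.
  by rewrite lerDl invr_ge0 mulr_ge0// ltW.
have y0 : z - x != 0 by rewrite subr_eq0.
have vz : visible x z by rewrite (star_shaped hc cO Ox).
have := @metric_line_bound x (z - x) 0 1 y0 ltr01 vz.
rewrite subr0 mulr1 scale0r addr0 => kF.
have zn : `|z| <= `|x| + `|z - x|.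
  by rewrite -{1}[z](subrK x) [z - x + x]addrC; exact: ler_normD.
apply: (le_trans zn); rewrite lerD2l -div1r ler_pdivlMr ?mulr_gt0//.
have H := mF (z - x); rewrite -(ler_pM2l k0) in H.
apply: le_trans kF; apply: le_trans H.
by move: (k) (`|z - x|) => k1 N1; rewrite mulrC [m * _]mulrC -mulrA.
Qed.

(** Backwards in time [F] decreases along the geodesic, so its speed stays
    above a positive constant and it would leave every bounded set. *)
Lemma not_backward_complete : bounded_set Omega ->
  forall x y, Omega x -> y != 0 -> ~ backward_complete Omega F.
Proof.
move=> bO x y Ox y0 hb.
have [e e0 [c [v [gc cx vx]]]] := geodesic_through Ox y0.
have gc01 : geodesic Omega F `]0, 1] c.
  exists v; apply: sub_geodesic gc => t; rewrite !in_itv/= => /andP[? ?].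
  by apply/andP; split=> //; exact: ltW.
have [c' gc' c'c] := hb c gc01.
have c'c1 : {in `]0, 1[, c' =1 c}.
  by move=> t; rewrite in_itv/= => /andP[t0 t1]; apply: c'c; rewrite in_itv/= t0 ltW.
have sub : {subset `]-oo, (1 : R)[ <= `]-oo, (1 : R)]}.
  by move=> t; rewrite !in_itv/= => /ltW.
have h1 : (2^-1 : R) < 1 by rewrite invf_lt1// ltr1n.
have h0 : (2^-1 : R) \in `]-oo, 1[ by rewrite in_itv/=.
have oJ : open [set` `]-oo, (1 : R)[] by exact: interval_open.
have [a [a1 [K K0 [ah aP]]]] :=
  extended_geodesic y0 e0 gc cx vx gc' c'c1 sub oJ h0.
have inJ t : t <= 2^-1 -> t \in `]-oo, (1 : R)[.
  by move=> ht; rewrite in_itv/= (le_lt_trans ht).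
pose g t := F (x + a t *: y) y.
have gx : g 2^-1 = F x y by rewrite /g ah scale0r addr0.
have Fx := finsler_pos hF Ox y0.
have g_le t : t <= 2^-1 -> g t <= F x y.
  rewrite le_eqVlt => /predU1P[->|ht]; first by rewrite gx.
  have [r /andP[_ rh]|r /andP[_ rh]] := @MVT_is_derive R g
      (fun r => 'D_(hor y) f (x + a r *: y, y) * a1 r) t 2^-1 ht.
    have [Or da _ _] := aP r (inJ r rh).
    exact: (@is_derive1_comp _ (fun s : R => F (x + s *: y) y) a r _ _
      (metric_line_is_derive hF y0 Or) da).
  have [Or _ a10 _] := aP r (inJ r (ltW rh)).
  rewrite gx => E; rewrite -subr_ge0 E mulr_ge0 ?subr_ge0 ?(ltW ht)//.
  rewrite mulr_ge0 ?(ltW a10)//.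
  apply: le_trans (derive_hor_ge oOmega hF hflat b0 hS Or y0).
  by rewrite mulr_ge0 ?sqr_ge0// ltW// rate_gt0.
apply: (bounded_set_ray bO y0 (x := x)) => N.
(* At speed at least K / F x y, this goes back beyond the parameter N. *)
pose T := 2^-1 - (`|N| + 1) * F x y / K.
have N1 : 0 < `|N| + 1 by rewrite ltr_wpDl.
have T2 : T < 2^-1 by rewrite ltrBlDr ltrDl divr_gt0// mulr_gt0.
exists (a T); last by have [] := aP T (inJ T (ltW T2)).
have [r /andP[_ rh]|r /andP[_ rh]] := @MVT_is_derive R a a1 T 2^-1 T2.
  by have [] := aP r (inJ r rh).
have [Or _ a1r aK] := aP r (inJ r (ltW rh)).
have gr : g r <= F x y := g_le r (ltW rh).
rewrite ah sub0r /T subKr => aT.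
rewrite -normrN aT normrM (gtr0_norm a1r) gtr0_norm; last by rewrite divr_gt0// mulr_gt0.
apply: (le_lt_trans (ler_norm N)); apply: (@lt_le_trans _ _ (`|N| + 1)); first by rewrite ltrDl.
rewrite mulrA ler_pdivlMr// mulrCA ler_pM2l// -aK.
by rewrite ler_pM2l.
Qed.

(** If [F x (- y) <= L * F x y], the opposite rays satisfy the bound of
    [forward_reach], since [F] decreases backwards along lines. *)
Lemma reversibility_infinite (hc : forward_complete Omega F) x y :
  bounded_set Omega -> Omega x -> y != 0 -> reversibility Omega F = +oo%E.
Proof.
move=> bO Ox y0.
have ub z w : Omega z -> w != 0 ->
    ((F z (- w) / F z w)%:E <= reversibility Omega F)%E.
  move=> Oz w0; apply: (@le_trans _ _ (ereal_sup [set (F z (- u) / F z u)%:E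
      | u in [set u : 'rV[R]_n | u != 0]])).
    by apply: ereal_sup_ubound; exists w.
  by apply: ereal_sup_ubound; exists z.
case E : (reversibility Omega F) => [L|//|]; last first.
  by have := ub x y Ox y0; rewrite E leeNy_eq.
exfalso; have L0 z w : Omega z -> w != 0 -> F z (- w) <= L * F z w.
  move=> Oz w0; have := ub z w Oz w0; rewrite E lee_fin ler_pdivrMr//.
  exact: (finsler_pos hF).
have Lge0 : 0 <= L.
  have Fx := finsler_pos hF Ox y0.
  rewrite -(pmulr_lge0 _ Fx); apply: le_trans (L0 x y Ox y0).
  by rewrite ltW// (finsler_pos hF)// oppr_eq0.
have ny0 : - y != 0 by rewrite oppr_eq0.
have back (s : R) : 0 <= s -> Omega (x + s *: - y).
  move=> s0; apply: (@ray_induction x (- y) s Ox); last by rewrite s0 lexx.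
  move=> S /andP[S0 _] OS.
  apply: (forward_reach hc (M := L * F x y) Ox ny0 S0) => r rS.
  have Or := OS r rS; split => //.
  apply: (le_trans (L0 _ _ Or y0)); apply: ler_wpM2l => //.
  case/andP: rS => r0 rS.
  have nr : - r <= 0 by rewrite oppr_le0.
  have := @metric_line_mono x y (- r) 0 y0 nr.
  rewrite scale0r addr0 scaleNr scalerN; apply => q /andP[rq q0].
  have := OS (- q); rewrite scaleNr scalerN opprK; apply.
  by rewrite oppr_ge0 q0 (le_lt_trans _ rS)// lerNl.
apply: (bounded_set_ray bO ny0 (x := x)) => N.
exists (`|N| + 1); last by apply: back; rewrite addr_ge0.
by rewrite ger0_norm ?addr_ge0// (le_lt_trans (ler_norm N))// ltrDl.
Qed.

End Completeness.

Theorem theorem1p3 (R : realType) (n : nat) (hn : (2 <= n)%N)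
    (Omega : set 'rV[R]_n) (F : 'rV[R]_n -> 'rV[R]_n -> R)
    (hOmega : domain Omega) (hF : finsler_metric Omega F)
    (hcomplete : forward_complete Omega F)
    (hflat : projectively_flat Omega F)
    (h : R) (hpos : 0 < h)
    (hS : S_curvature_ge Omega F ((n%:R - 1) * h)) :
  [/\ bounded_set Omega,
      ~ backward_complete Omega F
    & reversibility Omega F = +oo%E].
Proof.
have [neOmega oOmega cOmega] := hOmega.
have b0 : 0 < (n%:R - 1) * h by rewrite mulr_gt0// subr_gt0 ltr1n.
have bO := bounded_domain oOmega hF hflat b0 hS hcomplete cOmega neOmega.
have [x Ox] := neOmega.
have y0 : unitv R (Ordinal (ltnW hn)) != 0.
  apply/rV0Pn; exists (Ordinal (ltnW hn)); rewrite mxE !eqxx; exact: oner_neq0.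
split => //.
  exact: (not_backward_complete oOmega hF hflat b0 hS bO Ox y0).
exact: (reversibility_infinite oOmega hF hflat b0 hS hcomplete bO Ox y0).
Qed.
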